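(* Let $B$ satisfy the standing assumptions below. For every $\xi_0\in\mathcal{M}$ there is $T_R>0$, depending only on $|\xi_0|_{\mathcal{M}}$, such that there exists a unique solution $\xi\in C([0,T_R];\mathcal{M})$ of the flow equation $$\xi_t=\varphi^{t,B(\xi)}_\sharp\xi_0,\qquad t\in[0,T_R].$$
   Context: $\mathcal{M}$ is the dual of $C_b(\mathbb{R}^d;\mathbb{R}^d)$ (bounded continuous vector fields, sup norm $\|\cdot\|_\infty$) with dual norm $|\xi|_{\mathcal{M}}=\sup_{\|\theta\|_\infty\le1}|\xi(\theta)|$. Weak norm: $\|\xi\|=\sup\{\xi(\theta):\|\theta\|_\infty+\mathrm{Lip}(\theta)\le1\}$; $\mathcal{M}_w$ is $\mathcal{M}$ with metric $d(\xi,\xi')=\|\xi-\xi'\|$. Standing assumptions: $B:\mathcal{M}_w\to C_b^2(\mathbb{R}^d,\mathbb{R}^d)$ is continuous and there is $C_B>0$ with, for all $\xi,\xi'$: $\|B(\xi)\|_{C_b^2}\le C_B(\|\xi\|+1)$, $\|B(\xi)-B(\xi')\|_\infty\le C_B\|\xi-\xi'\|$, $\|DB(\xi)-DB(\xi')\|_\infty\le C_B\|\xi-\xi'\|$ ($D$ the spatial derivative). For a time-dependent current $\xi$, $\varphi^{t,B(\xi)}$ is the flow of $\frac{dx_t}{dt}=B(\xi_t)(x_t)$ with $\varphi^{0,B(\xi)}=\mathrm{id}$. Push-forward: for a $C^1$ map $\varphi$, $(\varphi_\sharp\theta)(x)=D\varphi(x)^T\theta(\varphi(x))$ and $(\varp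hi_\sharp\xi)(\theta)=\xi(\varphi_\sharp\theta)$.
   Formalization: Continuity of t ↦ ξ_t on [0,T_R] is taken in the weak norm ‖·‖ (values in M, i.e. C([0,T_R];M_w)), since continuity in |·|_M fails, e.g. for a vector Dirac mass transported by a constant field B. *)

(* Defs.v *)
(* R^d is 'rV[R]_d; quantitative norms are Euclidean. *)
From HB Require Import structures.
From mathcomp Require Import all_boot all_order all_algebra.
From mathcomp Require Import all_classical all_reals all_analysis.
Set Implicit Arguments. Unset Strict Implicit. Unset Printing Implicit Defensive.
Import Order.TTheory GRing.Theory Num.Theory.
Import numFieldNormedType.Exports.
Local Open Scope classical_set_scope.
Local Open Scope ring_scope.

Section Defs.
Variables (R : realType) (d : nat).
Local Notation V := 'rV[R]_d.

Definition edot (u v : V) : R := \sum_(i < d) u ord0 i * v ord0 i.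
Definition enorm (v : V) : R := Num.sqrt (edot v v).

Definition ebasis (j : 'I_d) : V := \row_(k < d) (k == j)%:R.
Definition pd (f : V -> V) (j : 'I_d) : V -> V := fun x => derive f x (ebasis j).

Definition supR (g : V -> R) : R := sup (range g).

Definition bdd (f : V -> V) : Prop := exists M : R, forall x, enorm (f x) <= M.
Definition Cb (f : V -> V) : Prop := continuous f /\ bdd f.
Definition supn (f : V -> V) : R := supR (fun x => enorm (f x)).

Definition C1 (f : V -> V) : Prop :=
  continuous f /\ (forall j x, derivable f x (ebasis j)) /\ (forall j, continuous (pd f j)).
Definition C2 (f : V -> V) : Prop := C1 f /\ forall j, C1 (pd f j).
Definition Cb2 (f : V -> V) : Prop :=
  C2 f /\ bdd f /\ (forall j, bdd (pd f j)) /\ (forall j k, bdd (pd (pd f j) k)).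

Definition Dnorm (f : V -> V) (x : V) : R :=
  Num.sqrt (\sum_(j < d) enorm (pd f j x) ^+ 2).
Definition D2norm (f : V -> V) (x : V) : R :=
  Num.sqrt (\sum_(j < d) \sum_(k < d) enorm (pd (pd f j) k x) ^+ 2).
Definition C2norm (f : V -> V) : R :=
  supR (fun x => enorm (f x)) + supR (Dnorm f) + supR (D2norm f).
Definition Ddist (f g : V -> V) : R :=
  supR (fun x => Num.sqrt (\sum_(j < d) enorm (pd f j x - pd g j x) ^+ 2)).

(* currents: (elements of) the dual of C_b, as functionals on vector fields,
   only their values on C_b matter *)
Definition current := (V -> V) -> R.
Definition isM (xi : current) : Prop :=
  (forall (a : R) th1 th2, Cb th1 -> Cb th2 ->
      xi (fun x => a *: th1 x + th2 x) = a * xi th1 + xi th2) /\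
  exists C : R, forall th, Cb th -> `|xi th| <= C * supn th.
Definition eqM (xi xi' : current) : Prop := forall th, Cb th -> xi th = xi' th.
Definition subM (xi xi' : current) : current := fun th => xi th - xi' th.

Definition normM (xi : current) : R :=
  sup [set `|xi th| | th in [set th | Cb th /\ supn th <= 1]].

(* ||th||_oo + Lip(th) <= 1 *)
Definition weak_ball (th : V -> V) : Prop :=
  Cb th /\ exists a b : R, [/\ 0 <= a, 0 <= b, a + b <= 1,
    (forall x, enorm (th x) <= a) &
    (forall x y, enorm (th x - th y) <= b * enorm (x - y))].
Definition wnorm (xi : current) : R := sup [set xi th | th in weak_ball].

Definition standing (B : current -> V -> V) : Prop :=
  (forall xi, isM xi -> Cb2 (B xi)) /\
  (forall xi, isM xi -> forall eps : R, 0 < eps -> exists2 delta : R, 0 < delta &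
     forall xi', isM xi' -> wnorm (subM xi' xi) < delta ->
       C2norm (fun x => B xi' x - B xi x) < eps) /\
  exists2 CB : R, 0 < CB &
   forall xi xi', isM xi -> isM xi' ->
     [/\ C2norm (B xi) <= CB * (wnorm xi + 1),
         supn (fun x => B xi x - B xi' x) <= CB * wnorm (subM xi xi') &
         Ddist (B xi) (B xi') <= CB * wnorm (subM xi xi')].

(* push-forward of a vector field by a C^1 map: x |-> Dphi(x)^T th(phi x) *)
Definition push_field (phi : V -> V) (th : V -> V) : V -> V :=
  fun x => \row_(j < d) edot (th (phi x)) (pd phi j x).

Definition is_flow (B : current -> V -> V) (xi : R -> current) (T : R)
    (phi : R -> V -> V) : Prop :=
  (forall x, phi 0 x = x) /\
  (forall x, {within `[0, T], continuous (fun s => phi s x)}) /\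
  (forall x t, 0 < t < T ->
     derivable (fun s => phi s x) t 1 /\
     derive (fun s => phi s x) t 1 = B (xi t) (phi t x)).

Definition flow_solution (B : current -> V -> V) (xi0 : current) (T : R)
    (xi : R -> current) : Prop :=
  (forall t, 0 <= t <= T -> isM (xi t)) /\
  (forall t, 0 <= t <= T -> forall eps : R, 0 < eps -> exists2 delta : R, 0 < delta &
     forall s, 0 <= s <= T -> `|s - t| < delta -> wnorm (subM (xi s) (xi t)) < eps) /\
  exists phi : R -> V -> V,
    [/\ is_flow B xi T phi,
        (forall t, 0 <= t <= T -> C1 (phi t)) &
        (forall t, 0 <= t <= T -> forall th, Cb th ->
            xi t th = xi0 (push_field (phi t) th))].
End Defs.

(* Main.v *)
Require Import Defs.
From HB Require Import structures.
From mathcomp Require Import all_boot all_order all_algebra.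
From mathcomp Require Import all_classical all_reals all_analysis.
From mathcomp Require Import ring lra.
Set Implicit Arguments. Unset Strict Implicit. Unset Printing Implicit Defensive.
Import Order.TTheory GRing.Theory Num.Theory.
Import numFieldNormedType.Exports.
Local Open Scope classical_set_scope.
Local Open Scope ring_scope.

(** Existence. The flow equation is an autonomous ODE for the pair [(phi, D phi)]: with
    [xi_t] the push-forward of [xi0] by [phi_t], one has [phi' = B(xi)(phi)] and
    [(D phi)' = DB(xi)(phi) D phi]. By the standing assumptions the right-hand side is Lipschitz
    for the sup norm on the set of pairs [(phi, A)] near [(id, 1)] with [A] Lipschitz and
    [|phi(x+v) - phi(x) - A(x) v| <= |v|^2], so Picard iteration converges on a short interval.
    The last condition is closed under pointwise limits and forces [A = D phi], so the limit is
    [C^1] without any variational equation.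

    Uniqueness. Let [phi], [phi'] be the flows of two solutions [xi], [xi'] with
    [||xi_t - xi'_t|| <= eps exp(la t)]. Gronwall bounds [phi - phi'] and the Lipschitz constant
    of [phi - phi'], hence also [D phi - D phi'], by [C eps exp(la t) / la] with [C] independent
    of [la]. Therefore [||xi_t - xi'_t|| <= (eps/2) exp(la t)] for [la] large; iterating gives
    [phi = phi'], and so [xi = xi'] on all of [C_b] (the weak norm alone would not separate
    elements of the dual of [C_b]). *)

(** * Real functions of one variable: mean value inequalities and primitives *)

Section ScalarCalculus.
Variable R : realType.
Implicit Types (f g h : R -> R) (c x y t : R).

(** Archimedean: if [y < x], some [n] exceeds [|c| / (x - y)], and [2 ^+ n] exceeds [n]. Every
    geometric convergence below passes to the limit through this inequality. *)
Lemma le_of_dyadic x y c : (forall n, x <= y + c / 2 ^+ n) -> x <= y.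
Proof.
move=> H; rewrite leNgt; apply/negP => yx.
have xy0 : 0 < x - y by rewrite subr_gt0.
have [n Hn] : exists n : nat, `|c| / (x - y) < n%:R.
  exists (Num.truncn (`|c| / (x - y))).+1.
  by have /andP[_ ->] := truncn_itv (divr_ge0 (normr_ge0 c) (ltW xy0)).
have n2 : n%:R < 2 ^+ n :> R by rewrite -natrX ltr_nat ltn_expl.
have p0 : 0 < 2 ^+ n :> R by rewrite exprn_gt0.
have : `|c| < (x - y) * 2 ^+ n.
  by rewrite mulrC -ltr_pdivrMr// (lt_trans Hn).
have := H n; rewrite -lerBlDl ler_pdivlMr// => h1 h2.
have := ler_norm c; lra.
Qed.

Lemma continuous_of_lipschitz f c : (forall x y, `|f x - f y| <= c * `|x - y|) -> continuous f.
Proof.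
move=> H x; apply/cvgrPdist_lt => e e0.
have c0 : 0 < `|c| + 1 by rewrite ltr_wpDl.
near=> y; apply: (le_lt_trans (H x y)).
apply: (@le_lt_trans _ _ ((`|c| + 1) * `|x - y|)).
  by rewrite ler_wpM2r// (le_trans (ler_norm c))// lerDl.
rewrite mulrC -ltr_pdivlMr//; near: y.
by apply: (@cvgr_dist_lt _ R _ _ _ id) => //; exact: divr_gt0.
Unshelve. all: by end_near. Qed.

Lemma within_continuous_derive f df a b : (forall x, a <= x <= b -> is_derive x 1 f (df x)) ->
  {within `[a, b], continuous f}.
Proof.
move=> H; apply: derivable_within_continuous => x; rewrite in_itv/= => xab.
by have := H x xab => -[].
Qed.

(** The mean value theorem is applied to [g - s * f] for [s] equal to 1 and to -1; both functions
    have a nonnegative derivative. *)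
Lemma norm_sub_le_derive f g df dg a b : a <= b ->
  (forall x, a < x < b -> is_derive x 1 f (df x)) ->
  (forall x, a < x < b -> is_derive x 1 g (dg x)) ->
  {within `[a, b], continuous f} -> {within `[a, b], continuous g} ->
  (forall x, a < x < b -> `|df x| <= dg x) ->
  `|f b - f a| <= g b - g a.
Proof.
rewrite le_eqVlt => /orP[/eqP <-|ab] Hf Hg cf cg H.
  by rewrite !subrr normr0.
have mono (s : R) : `|s| = 1 -> s * (f b - f a) <= g b - g a.
  move=> s1.
  have [||c cab E] := @MVT _ (fun x => g x - s * f x) (fun x => dg x - s * df x) _ _ ab.
  - move=> x; rewrite in_itv/= => xab.
    have := Hf x xab; have := Hg x xab => ? ?.
    have ? : is_derive x 1 (fun x => s * f x) (s * df x) by exact: is_deriveZ.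
    exact: is_deriveB.
  - move=> x; apply: cvgB; first exact: cg.
    by apply: cvgM; [exact: cvg_cst|exact: cf].
  have : 0 <= (dg c - s * df c) * (b - a).
    rewrite mulr_ge0 ?subr_ge0 ?(ltW ab)//.
    have := H c; move: cab; rewrite in_itv/= => -> /(_ isT); apply: le_trans.
    by rewrite (le_trans (ler_norm _))// normrM s1 mul1r.
  rewrite -E; lra.
have := mono 1; have := mono (-1); rewrite normrN normr1 => /(_ erefl) h1 /(_ erefl) h2.
rewrite ler_norml; apply/andP; split; lra.
Qed.

Lemma norm_sub_le_derive_cst f df a b c : a <= b ->
  (forall x, a < x < b -> is_derive x 1 f (df x)) ->
  {within `[a, b], continuous f} ->
  (forall x, a < x < b -> `|df x| <= c) ->
  `|f b - f a| <= c * (b - a).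
Proof.
move=> ab Hf cf H; rewrite mulrBr.
have Hg x : is_derive x (1 : R) (fun x => c * x) c.
  have := is_deriveZ c (is_derive_id x (1 : R)) => /is_derive_eq; apply.
  by rewrite /GRing.scale/= mulr1.
apply: (@norm_sub_le_derive f (fun x => c * x) df (fun=> c)) => //.
by apply: (@within_continuous_derive _ (fun=> c)).
Qed.

Lemma primitive_exists f : continuous f ->
  exists G, G 0 = 0 /\ forall t, 0 <= t -> is_derive t 1 G (f t).
Proof.
move=> cf.
(* Integration starts at -1, so that 0 is an interior point and the two-sided derivative exists
   there too. *)
pose F x := (\int[@lebesgue_measure R]_(t in [set` Interval (BLeft (-1 : R)) (BRight x)]) (f t))%R.
exists (fun t => F t - F 0); split; first by rewrite subrr.
move=> t t0.
have [dF F'] : derivable F t 1 /\ derive1 F t = f t.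
  apply: (@continuous_FTC1 _ f (BLeft (-1 : R)) t (t + 1)).
  - by rewrite ltrDl.
  - apply: continuous_compact_integrable; first exact: segment_compact.
    exact: continuous_subspaceT.
  - by rewrite lte_fin; lra.
  - exact: cf.
have ? : is_derive t (1 : R) F (f t) by apply: DeriveDef => //; rewrite -derive1E.
have ? := is_derive_cst (F 0) t (1 : R).
by apply: is_derive_eq; rewrite subr0.
Qed.

(** A choice of primitive, total in [f], so that [picard_step] applies to arbitrary curves; the
    default is the zero function. *)
Definition primitive f : R -> R :=
  xget (fun=> 0) [set G | G 0 = 0 /\ forall t, 0 <= t -> is_derive t 1 G (f t)].

Lemma primitiveP f : continuous f ->
  primitive f 0 = 0 /\ forall t, 0 <= t -> is_derive t 1 (primitive f) (f t).
Proof. by move=> /primitive_exists[G HG]; rewrite /primitive; case: xgetP => [G' -> //|/(_ G)]. Qed.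

End ScalarCalculus.

(** * Finitely supported linear forms *)

Section LinearForms.
Variables (R : realType) (I : Type).
Implicit Types (s : seq (R * I)) (u v : I -> R).

(** The linear form on [I -> R] given by a list of coefficients and indices. *)
Definition ev s u : R := \sum_(p <- s) p.1 * u p.2.

Lemma ev_nil u : ev [::] u = 0. Proof. by rewrite /ev big_nil. Qed.

Lemma ev_cons p s u : ev (p :: s) u = p.1 * u p.2 + ev s u.
Proof. by rewrite /ev big_cons. Qed.

Lemma evD s u v : ev s (fun i => u i + v i) = ev s u + ev s v.
Proof. by rewrite /ev -big_split/=; apply: eq_bigr => p _; rewrite mulrDr. Qed.

(** Continuity for uniform convergence, which lets linear constraints survive the limit of the
    Picard iterates. *)
Lemma ev_dist s u v (e : R) : (forall i, `|u i - v i| <= e) ->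
  `|ev s u - ev s v| <= (\sum_(p <- s) `|p.1|) * e.
Proof.
move=> H; rewrite /ev -sumrB mulr_suml (le_trans (ler_norm_sum _ _ _))//.
by apply: ler_sum => p _; rewrite -mulrBr normrM ler_wpM2l.
Qed.

Lemma is_derive_ev s (w : R -> I -> R) (w' : I -> R) (t : R) :
  (forall i, is_derive t 1 (fun x => w x i) (w' i)) ->
  is_derive t 1 (fun x => ev s (w x)) (ev s w').
Proof.
move=> H; elim: s => [|p s IH].
  have -> : (fun x => ev [::] (w x)) = cst 0 by apply/funext => x; rewrite ev_nil.
  by rewrite ev_nil; exact: is_derive_cst.
have := is_deriveD (is_deriveZ p.1 (H p.2)) IH.
rewrite ev_cons; congr is_derive; apply/funext => x; by rewrite ev_cons.
Qed.

End LinearForms.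

(** * Picard iteration under linear constraints *)

Section Picard.
Variables (R : realType) (I : Type) (u0 : I -> R) (F : (I -> R) -> I -> R).
Variables (C : seq (R * I) -> R -> Prop) (T L K : R).

(* The constraints are linear in the state, so a bound [c] on [ev s] of the vector field
   integrates in time to the bound [T * c] on the displacement from [u0]. *)
Definition admissible (u : I -> R) :=
  forall s c, C s c -> `|ev s u - ev s u0| <= T * c.

(** Freezing time outside the interval from 0 to [T] makes every curve defined on all of [R]. *)
Definition clamp (t : R) : R := Num.min (Num.max t 0) T.

Definition picard_step (u : R -> I -> R) : R -> I -> R :=
  fun t i => u0 i + primitive (fun s => F (u s) i) (clamp t).

(** The space on which the iteration contracts. The Lipschitz clause in time makes each [F (u s) i]
    continuous in [s], so that it has a primitive. *)
Definition picard_curve (u : R -> I -> R) :=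
  (forall t, admissible (u t)) /\ forall i s t, `|u s i - u t i| <= K * `|s - t|.

Hypothesis T_gt0 : 0 < T.
Hypothesis K_gt0 : 0 < K.
Hypothesis L_ge0 : 0 <= L.
Hypothesis TL : T * L <= 2^-1.
Hypothesis C_ge0 : forall s c, C s c -> 0 <= c.
Hypothesis F_C : forall u, admissible u -> forall s c, C s c -> `|ev s (F u)| <= c.
Hypothesis F_bounded : forall u, admissible u -> forall i, `|F u i| <= K.
Hypothesis F_lip : forall u v (D : R), admissible u -> admissible v -> 0 < D ->
  (forall i, `|u i - v i| <= D) -> forall i, `|F u i - F v i| <= L * D.

Lemma clamp_itv t : 0 <= clamp t <= T.
Proof. by rewrite /clamp le_min ge_min le_max !lexx orbT (ltW T_gt0) orbT. Qed.

Lemma clamp_id t : 0 <= t <= T -> clamp t = t.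
Proof. by move=> /andP[t0 tT]; rewrite /clamp max_l// min_l. Qed.

Lemma clamp_dist s t : `|clamp s - clamp t| <= `|s - t|.
Proof.
rewrite /clamp /Num.min /Num.max; have := T_gt0.
have := ler_norm (s - t); have := ler_norm (t - s); rewrite (distrC t s) => h1 h2 h3.
case: (ltP s 0) => ?; case: (ltP t 0) => ?; rewrite ?h3;
  case: (ltP s T) => ?; case: (ltP t T) => ?; rewrite ler_norml; apply/andP; split; lra.
Qed.

Let Fc u i : picard_curve u -> continuous (fun s => F (u s) i).
Proof.
move=> [Su Lu]; apply: (@continuous_of_lipschitz _ _ (L * K)) => x y.
(* [F_lip] asks for a positive distance, so equal times are treated apart. *)
have [->|xy] := eqVneq x y; first by rewrite !subrr normr0 mulr0.
rewrite -mulrA; apply: F_lip => //.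
by rewrite mulr_gt0// normr_gt0 subr_eq0.
Qed.

Let primD u i (t : R) : picard_curve u -> 0 <= t ->
  is_derive t 1 (primitive (fun s => F (u s) i)) (F (u t) i).
Proof. by move=> uS t0; have [_] := primitiveP (@Fc u i uS); exact. Qed.

Let prim0 u i : picard_curve u -> primitive (fun s => F (u s) i) 0 = 0.
Proof. by move=> uS; have [->] := primitiveP (@Fc u i uS). Qed.

(** A linear form commutes with integration in time, so the bound [c] on the vector field becomes
    [T * c] on the displacement; the speed bound [K] gives the Lipschitz clause. *)
Lemma picard_step_curve u : picard_curve u -> picard_curve (picard_step u).
Proof.
move=> uS; split.
  move=> t s c Csc; have /andP[t0 tT] := clamp_itv t.
  rewrite evD addrAC subrr add0r.
  have D (x : R) : 0 <= x -> is_derive x 1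
      (fun x => ev s (fun i => primitive (fun s => F (u s) i) x)) (ev s (F (u x))).
    by move=> x0; apply: is_derive_ev => i; exact: primD.
  have := @norm_sub_le_derive_cst _ (fun x => ev s (fun i => primitive (fun s => F (u s) i) x))
     (fun x => ev s (F (u x))) 0 (clamp t) c t0.
  have -> : ev s (fun i => primitive (fun s => F (u s) i) 0) = 0.
    by rewrite /ev big1// => p _; rewrite prim0// mulr0.
  rewrite !subr0 => /(_ _ _ _)/le_trans; apply => //.
  - by move=> x /andP[x0 _]; apply: D; exact: ltW.
  - by apply: (@within_continuous_derive _ _ (fun x => ev s (F (u x)))) => x /andP[x0 _]; exact: D.
  - by move=> x _; apply: F_C => //; exact: uS.1.
  - by rewrite mulrC ler_wpM2r// (C_ge0 Csc).
move=> i.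
have main s t : clamp t <= clamp s -> `|picard_step u s i - picard_step u t i| <= K * `|s - t|.
  move=> st; rewrite /picard_step opprD addrACA subrr add0r.
  have /andP[t0 tT] := clamp_itv t.
  apply: (@le_trans _ _ (K * (clamp s - clamp t))).
    apply: (@norm_sub_le_derive_cst _ _ (fun x => F (u x) i)) => //.
    - by move=> x /andP[x0 _]; apply: primD => //; rewrite (le_trans t0)// ltW.
    - apply: (@within_continuous_derive _ _ (fun x => F (u x) i)) => x /andP[x0 _].
      by apply: primD => //; rewrite (le_trans t0).
    - by move=> x _; apply: F_bounded; exact: uS.1.
  by rewrite ler_pM2l// (le_trans (ler_norm _))// clamp_dist.
move=> s t; have [/main //|/ltW/main] := leP (clamp t) (clamp s).
by rewrite distrC (distrC s).
Qed.

(** The two velocities differ by at most [L * D] over a time at most [T], and [T * L <= 2^-1]. *)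
Lemma picard_step_contract u v (D : R) : picard_curve u -> picard_curve v -> 0 < D ->
  (forall t i, `|u t i - v t i| <= D) ->
  forall t i, `|picard_step u t i - picard_step v t i| <= D / 2.
Proof.
move=> uS vS D0 H t i; have /andP[t0 tT] := clamp_itv t.
rewrite /picard_step opprD addrACA subrr add0r.
set p := primitive _; set q := primitive _.
have d (x : R) : 0 <= x -> is_derive x 1 (fun x => p x - q x) (F (u x) i - F (v x) i).
  by move=> x0; have := @primD _ i _ uS x0; have := @primD _ i _ vS x0 => ? ?; exact: is_deriveB.
have := @norm_sub_le_derive_cst _ (fun x => p x - q x)
     (fun x => F (u x) i - F (v x) i) 0 (clamp t) (L * D) t0.
rewrite /p /q !prim0// !subr0 => /(_ _ _ _)/le_trans; apply => //.
- by move=> x /andP[x0 _]; apply: d; exact: ltW.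
- by apply: (@within_continuous_derive _ _ (fun x => F (u x) i - F (v x) i)) => x /andP[x0 _]; exact: d.
- by move=> x _; apply: F_lip => //; [exact: uS.1|exact: vS.1].
- have h1 : L * clamp t <= 2^-1 by rewrite (le_trans _ TL)// mulrC ler_wpM2r.
  by rewrite mulrAC mulrC ler_pM2l.
Qed.

Let it n : R -> I -> R := iter n picard_step (fun=> u0).

Let it_curve n : picard_curve (it n).
Proof.
elim: n => [|n IH]; last exact: picard_step_curve.
split=> [t s c /C_ge0 c0|i s t]; rewrite subrr normr0 mulr_ge0//; exact: ltW.
Qed.

Let c0 := K * T.
Let c0_gt0 : 0 < c0. Proof. exact: mulr_gt0. Qed.

(** The first iterate starts at [u0] with speed at most [K], hence stays within [K * T] of it; each
    further step halves the distance. *)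
Let it_step n t i : `|it n.+1 t i - it n t i| <= c0 / 2 ^+ n.
Proof.
elim: n t i => [|n IH] t i.
  rewrite expr0 divr1.
  have /andP[t0 tT] := clamp_itv t.
  have := (it_curve 1).2 i (clamp t) 0.
  have -> : it 1 0 i = u0 i.
    by rewrite /= /picard_step clamp_id ?lexx ?ltW// prim0 ?addr0//; exact: (it_curve 0).
  have -> : it 1 (clamp t) i = it 1 t i by rewrite /= /picard_step (clamp_id (clamp_itv t)).
  rewrite subr0 (ger0_norm t0) => /le_trans; apply.
  by rewrite ler_pM2l.
rewrite exprS invfM mulrCA mulrC.
apply: (@picard_step_contract (it n.+1) (it n)) => //; try exact: it_curve.
by rewrite divr_gt0// exprn_gt0.
Qed.

(** The steps from stage [n] on sum to at most [2 * c0 / 2 ^+ n], so the intervals from [lo n] to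
    [hi n] are nested. *)
Let lo n t i := it n t i - 2 * c0 / 2 ^+ n.
Let hi n t i := it n t i + 2 * c0 / 2 ^+ n.

Let half_pow n : c0 / 2 ^+ n = 2 * c0 / 2 ^+ n.+1.
Proof. by rewrite exprS invfM; field; rewrite expf_neq0. Qed.

Let pow_split n : 2 * c0 / 2 ^+ n = c0 / 2 ^+ n + c0 / 2 ^+ n.
Proof. by field; rewrite expf_neq0. Qed.

Let lo_le n m t i : lo n t i <= lo (n + m) t i.
Proof.
elim: m => [|m IH]; first by rewrite addn0.
apply: (le_trans IH); rewrite addnS /lo -half_pow pow_split.
have := it_step (n + m) t i; rewrite ler_norml => /andP[h1 h2]; lra.
Qed.

Let hi_le n m t i : hi (n + m) t i <= hi n t i.
Proof.
elim: m => [|m IH]; first by rewrite addn0.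
apply: le_trans IH; rewrite addnS /hi -half_pow pow_split.
have := it_step (n + m) t i; rewrite ler_norml => /andP[h1 h2]; lra.
Qed.

Let lo_hi n m t i : lo n t i <= hi m t i.
Proof.
apply: (le_trans (lo_le n m t i)); apply: le_trans (hi_le m n t i).
rewrite (addnC m n) /lo /hi.
have : 0 <= 2 * c0 / 2 ^+ (n + m) by rewrite divr_ge0 ?exprn_ge0// mulr_ge0// ltW.
lra.
Qed.

(* [lo] is nondecreasing and [hi] nonincreasing in [n], which squeezes the iterates. *)
Let lim t i := sup (range (fun n => lo n t i)).

Let limP n t i : `|it n t i - lim t i| <= 2 * c0 / 2 ^+ n.
Proof.
have hs : has_sup (range (fun n => lo n t i)).
  split; first by exists (lo 0 t i), 0%N.
  by exists (hi 0 t i) => _ [m _ <-]; exact: lo_hi.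
have h1 : lo n t i <= lim t i by apply: ub_le_sup; [case: hs|exists n].
have h2 : lim t i <= hi n t i by apply: ge_sup; [case: hs|move=> _ [m _ <-]; exact: lo_hi].
rewrite ler_norml; apply/andP; move: h1 h2; rewrite /lo /hi; split; lra.
Qed.

Let lim_curve : picard_curve lim.
Proof.
split=> [t s c Csc|i s t].
  apply: (@le_of_dyadic _ _ _ ((\sum_(p <- s) `|p.1|) * (2 * c0))) => n.
  have := (it_curve n).1 t s c Csc.
  have : `|ev s (lim t) - ev s (it n t)| <= (\sum_(p <- s) `|p.1|) * (2 * c0 / 2 ^+ n).
    by apply: ev_dist => i; rewrite distrC; exact: limP.
  rewrite mulrA => h1 h2.
  rewrite -(subrK (ev s (it n t)) (ev s (lim t))) -addrA (le_trans (ler_normD _ _))//.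
  by rewrite (addrC (T * c)) lerD.
apply: (@le_of_dyadic _ _ _ (4 * c0)) => n.
have := (it_curve n).2 i s t; have := limP n s i; have := limP n t i.
have -> : 4 * c0 / 2 ^+ n = 2 * c0 / 2 ^+ n + 2 * c0 / 2 ^+ n by field; rewrite expf_neq0.
rewrite !ler_norml => /andP[? ?] /andP[? ?] /andP[? ?]; apply/andP; split; lra.
Qed.

(** Both sides are compared with the iterate [it n.+1]: the left one by [limP], the right one by
    contraction. *)
Let lim_fix t i : lim t i = picard_step lim t i.
Proof.
apply/eqP; rewrite -subr_eq0 -normr_le0.
apply: (@le_of_dyadic _ _ _ (2 * c0)) => n; rewrite add0r.
have h1 := limP n.+1 t i.
have h2 : `|picard_step (it n) t i - picard_step lim t i| <= 2 * c0 / 2 ^+ n / 2.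
  apply: picard_step_contract => //; try exact: it_curve.
  by rewrite divr_gt0 ?exprn_gt0// mulr_gt0.
have -> : 2 * c0 / 2 ^+ n = 2 * c0 / 2 ^+ n.+1 + 2 * c0 / 2 ^+ n / 2.
  by rewrite exprS invfM; field; rewrite expf_neq0.
move: h1 h2; rewrite -/(it n.+1) -[picard_step (it n)]/(it n.+1).
rewrite !ler_norml => /andP[? ?] /andP[? ?]; apply/andP; split; lra.
Qed.

Lemma picard : exists u : R -> I -> R,
  [/\ forall i, u 0 i = u0 i, forall t, admissible (u t),
      forall i s t, `|u s i - u t i| <= K * `|s - t| &
      forall i t, 0 < t < T -> is_derive t 1 (fun s => u s i) (F (u t) i)].
Proof.
exists lim; split.
- move=> i; rewrite lim_fix /picard_step clamp_id ?lexx ?ltW// prim0 ?addr0//.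
- by case: lim_curve.
- by case: lim_curve.
- move=> i t /andP[t0 tT].
  have d : is_derive t 1 (fun x => u0 i + primitive (fun s => F (lim s) i) x) (F (lim t) i).
    have := is_deriveD (is_derive_cst (u0 i) t (1 : R)) (@primD _ i _ lim_curve (ltW t0)).
    by rewrite add0r.
  apply: near_eq_is_derive d => //.
  (* Near an interior time [clamp] is the identity, so the fixed point equation can be
     differentiated. *)
  near=> x; rewrite lim_fix /picard_step clamp_id//.
  by apply/andP; split; apply/ltW; near: x; [exact: lt_nbhsr|exact: lt_nbhsl].
Unshelve. all: by end_near. Qed.

End Picard.

(** * Taylor and Lipschitz estimates from partial derivatives *)

Section VectorCalculus.
Variables (R : realType) (d : nat).
Local Notation V := 'rV[R]_d.
Implicit Types (u v x y z : V).

(** The l1 norm, chosen because it adds up exactly along axis-parallel paths. *)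
Definition n1 v : R := \sum_(i < d) `|v ord0 i|.

Lemma n1_ge0 v : 0 <= n1 v. Proof. exact: sumr_ge0. Qed.

Lemma n10 : n1 0 = 0.
Proof. by rewrite /n1 big1// => i _; rewrite mxE normr0. Qed.

Lemma coord_le_n1 v i : `|v ord0 i| <= n1 v.
Proof. by rewrite /n1 (bigD1 i)//= lerDl sumr_ge0. Qed.

Lemma n1D u v : n1 (u + v) <= n1 u + n1 v.
Proof. by rewrite /n1 -big_split/=; apply: ler_sum => i _; rewrite mxE ler_normD. Qed.

Lemma n1_le v (c : R) : (forall i, `|v ord0 i| <= c) -> n1 v <= d%:R * c.
Proof.
move=> H; have : n1 v <= \sum_(i < d) c by apply: ler_sum.
by rewrite sumr_const card_ord mulr_natl.
Qed.

Lemma n1_mono u v : (forall i, `|u ord0 i| <= `|v ord0 i|) -> n1 u <= n1 v.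
Proof. by move=> H; apply: ler_sum. Qed.

Lemma n1_ebasisZ (h : R) (j : 'I_d) : n1 (h *: ebasis R j) = `|h|.
Proof.
rewrite /n1 (bigD1 j)//= !mxE eqxx mulr1 big1 ?addr0// => k kj.
by rewrite !mxE (negbTE kj) mulr0 normr0.
Qed.

Lemma edot_ge0 v : 0 <= edot v v.
Proof. by apply: sumr_ge0 => i _; rewrite -expr2 sqr_ge0. Qed.

Lemma coord_le_enorm v i : `|v ord0 i| <= enorm v.
Proof.
rewrite -sqrtr_sqr ler_sqrt ?edot_ge0// /edot (bigD1 i)//= -expr2 lerDl.
by apply: sumr_ge0 => j _; rewrite -expr2 sqr_ge0.
Qed.

Lemma enorm_ge0 v : 0 <= enorm v. Proof. exact: sqrtr_ge0. Qed.

Lemma enorm_le_n1 v : enorm v <= n1 v.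
Proof.
rewrite -[n1 v]ger0_norm ?n1_ge0// -sqrtr_sqr ler_sqrt ?sqr_ge0// expr2 {1}/n1 mulr_suml.
apply: ler_sum => i _; rewrite (le_trans (ler_norm _))// normrM.
by rewrite ler_wpM2l// coord_le_n1.
Qed.

Lemma enorm_le (v : V) (c : R) : (forall i, `|v ord0 i| <= c) -> enorm v <= d%:R * c.
Proof. by move=> /n1_le; apply: le_trans; exact: enorm_le_n1. Qed.

Lemma coord_le_norm v i : `|v ord0 i| <= `|v|.
Proof.
rewrite [leRHS]/Num.Def.normr/= mx_normrE.
exact: (le_bigmax _ (fun ij => `|v ij.1 ij.2|) (ord0, i)).
Qed.

Lemma norm_le v (c : R) : 0 <= c -> (forall i, `|v ord0 i| <= c) -> `|v| <= c.
Proof.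
move=> c0 H; rewrite [leLHS]/Num.Def.normr/= mx_normrE.
by apply: bigmax_le => // -[i j] _ /=; rewrite (ord1 i).
Qed.

Lemma cvg_row (U : Type) (F : set_system U) {FF : Filter F} (f : U -> V) v :
  (forall i, (fun t => f t ord0 i) @ F --> v ord0 i) -> f @ F --> v.
Proof.
move=> H; apply/cvgrPdist_le => e e0; near=> t.
apply: norm_le; first exact: ltW.
near: t; apply: filter_forall => i.
have /cvgrPdist_le/(_ e e0) := H i.
by apply: filterS => t; rewrite !mxE.
Unshelve. all: by end_near. Qed.

Lemma continuous_row (U : topologicalType) (f : U -> V) :
  (forall i, continuous (fun t => f t ord0 i)) -> continuous f.
Proof. by move=> H t; apply: cvg_row => i; exact: H. Qed.

Lemma continuous_coord (U : topologicalType) (f : U -> V) i :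
  continuous f -> continuous (fun t => f t ord0 i).
Proof. move=> cf t; apply: (@continuous_comp _ _ _ f (fun M : V => M ord0 i)).
  exact: cf.
exact: coord_continuous. Qed.

Lemma continuous_of_n1_lip (f : V -> V) (c : R) :
  (forall x y i, `|f x ord0 i - f y ord0 i| <= c * n1 (x - y)) -> continuous f.
Proof.
move=> H; apply: continuous_row => i x.
apply/(@cvgrPdist_lt _ R _ (nbhs x) (nbhs_filter x)) => e e0.
have c0 : 0 < `|c| * d%:R + 1 by rewrite ltr_wpDl// mulr_ge0.
near=> y; apply: (le_lt_trans (H x y i)).
apply: (@le_lt_trans _ _ ((`|c| * d%:R + 1) * `|x - y|)).
  apply: (@le_trans _ _ (`|c| * n1 (x - y))); first by rewrite ler_wpM2r ?n1_ge0// ler_norm.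
  apply: (@le_trans _ _ (`|c| * (d%:R * `|x - y|))).
    by rewrite ler_wpM2l// n1_le// => j; exact: coord_le_norm.
  by rewrite mulrA ler_wpM2r// lerDl.
rewrite mulrC -ltr_pdivlMr//; near: y.
by apply: (@cvgr_dist_lt _ V _ _ _ id) => //; exact: divr_gt0.
Unshelve. all: by end_near. Qed.

Lemma is_derive_coord (W : normedModType R) (f : W -> V) (t w : W) (v : V) i :
  is_derive t w f v -> is_derive t w (fun s => f s ord0 i) (v ord0 i).
Proof.
move=> [df <-]; apply: DeriveDef; first by move/derivable_mxP: df; exact.
by rewrite derive_mx// mxE.
Qed.

Lemma is_derive_row (W : normedModType R) (f : W -> V) (t w : W) (v : V) :
  (forall i, is_derive t w (fun s => f s ord0 i) (v ord0 i)) -> is_derive t w f v.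
Proof.
move=> H.
have df : derivable f t w by apply/derivable_mxP => i j; rewrite (ord1 i); have [] := H j.
apply: DeriveDef => //; rewrite derive_mx//; apply/rowP => j; rewrite mxE.
by have [] := H j.
Qed.

Lemma is_derive_line (f : V -> R) (g : V -> R) (e z : V) (r : R) :
  (forall x, is_derive x e f (g x)) ->
  is_derive r 1 (fun r : R => f (r *: e + z)) (g (r *: e + z)).
Proof.
move=> H; have [df <-] := H (r *: e + z).
have E : (fun h : R => h^-1 *: (((fun r : R => f (r *: e + z)) \o shift r) (h *: (1 : R)) - f (r *: e + z)))
       = (fun h => h^-1 *: ((f \o shift (r *: e + z)) (h *: e) - f (r *: e + z))).
  apply/funext => h /=; congr (_ *: (f _ - _)).
  by rewrite [h *: (1 : R)]mulr1 scalerDl addrA.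
by apply: DeriveDef; rewrite ?/derivable /derive E.
Qed.

Lemma is_derive_shift (f : V -> R) (e z x : V) (D : R) :
  is_derive (x + z) e f D -> is_derive x e (fun x => f (x + z)) D.
Proof.
move=> [df <-].
have E : (fun h : R => h^-1 *: (((fun x => f (x + z)) \o shift x) (h *: e) - f (x + z)))
       = (fun h => h^-1 *: ((f \o shift (x + z)) (h *: e) - f (x + z))).
  by apply/funext => h /=; rewrite addrA.
by apply: DeriveDef; rewrite ?/derivable /derive E.
Qed.

(** Subtracting the linear part leaves a function of [r] whose derivative is at most [M] in absolute
    value between 0 and [s]. *)
Lemma line_taylor (f g : V -> R) (e z : V) (s c M : R) :
  (forall x, is_derive x e f (g x)) ->
  (forall r, `|r| <= `|s| -> `|g (r *: e + z) - c| <= M) ->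
  `|f (s *: e + z) - f z - s * c| <= M * `|s|.
Proof.
move=> Hf Hg.
pose h (r : R) := f (r *: e + z) - r * c.
have dh (r : R) : is_derive r 1 h (g (r *: e + z) - c).
  have h1 := is_derive_line z r Hf.
  have h2 : is_derive r 1 (fun r : R => r * c) c.
    have := is_deriveZ c (is_derive_id r (1 : R)).
    rewrite /GRing.scale/= mulr1; congr is_derive; apply/funext => q /=; exact: mulrC.
  exact: is_deriveB.
have ch a b : {within `[a, b], continuous h}.
  by apply: (@within_continuous_derive _ _ (fun r => g (r *: e + z) - c)).
have E : f (s *: e + z) - f z - s * c = h s - h 0.
  by rewrite /h scale0r add0r mul0r subr0 addrAC.
rewrite E; have [s0|s0] := leP 0 s.
  rewrite -{2}[s]subr0 [`|_ - 0|]ger0_norm ?subr0// -{2}[s]subr0.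
  apply: (@norm_sub_le_derive_cst _ h (fun r => g (r *: e + z) - c)) => //.
  by move=> r /andP[r0 rs]; apply: Hg; rewrite !ger0_norm// ltW.
rewrite distrC (ltr0_norm s0) -[- s]add0r.
apply: (@norm_sub_le_derive_cst _ h (fun r => g (r *: e + z) - c)) => //; first exact: ltW.
by move=> r /andP[sr r0]; apply: Hg; rewrite !ltr0_norm// lerN2 ltW.
Qed.

(** The [k]-th corner of the axis-parallel path from 0 to [v]. *)
Definition truncv (k : nat) v : V := \row_(j < d) (if (j < k)%N then v ord0 j else 0).

Lemma truncv0 v : truncv 0 v = 0. Proof. by apply/rowP => j; rewrite !mxE. Qed.

Lemma truncv_full v : truncv d v = v.
Proof. by apply/rowP => j; rewrite !mxE ltn_ord. Qed.

Lemma truncvS (k : 'I_d) v : truncv k.+1 v = v ord0 k *: ebasis R k + truncv k v.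
Proof.
apply/rowP => j; rewrite !mxE ltnS leq_eqVlt.
have [->|jk] := eqVneq j k; first by rewrite eqxx ltnn mulr1 addr0.
by rewrite (_ : (val j == val k) = false) ?mulr0 ?add0r//; apply/negbTE.
Qed.

(* The increment is cut into [d] axis-parallel steps, so only partial derivatives matter. *)
Lemma partial_taylor (f : V -> R) (g : 'I_d -> V -> R) (c : 'I_d -> R) x v (M : R) :
  (forall j x, is_derive x (ebasis R j) f (g j x)) ->
  (forall j z, n1 (z - x) <= n1 v -> `|g j z - c j| <= M) ->
  `|f (v + x) - f x - \sum_(j < d) v ord0 j * c j| <= M * n1 v.
Proof.
move=> Hf Hg.
suff H k : (k <= d)%N ->
    `|f (truncv k v + x) - f x - \sum_(j < d | (j < k)%N) v ord0 j * c j|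
      <= M * \sum_(j < d | (j < k)%N) `|v ord0 j|.
  have := H d (leqnn d); rewrite truncv_full /n1.
  by under eq_bigl => j do rewrite ltn_ord; under [X in M * X]eq_bigl => j do rewrite ltn_ord.
elim: k => [|k IH] kd; first by rewrite truncv0 add0r subrr !big_pred0// subr0 normr0 mulr0.
have {}IH := IH (ltnW kd).
pose ok := Ordinal kd.
have split_sum (F : 'I_d -> R) :
    \sum_(j < d | (j < k.+1)%N) F j = F ok + \sum_(j < d | (j < k)%N) F j.
  rewrite (bigD1 ok)//=; congr (_ + _); apply: eq_bigl => j.
  rewrite ltnS [in LHS]leq_eqVlt -val_eqE/=.
  by case: eqP => [->|_]; rewrite ?ltnn ?andbT ?andbF.
rewrite !split_sum.
have -> : truncv k.+1 v + x = v ord0 ok *: ebasis R ok + (truncv k v + x).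
  by rewrite -[k.+1]/(ok.+1) truncvS addrA.
have := @line_taylor f (g ok) (ebasis R ok) (truncv k v + x) (v ord0 ok) (c ok) M (Hf ok).
move=> /(_ _)/wrap[r rs|H].
  (* Between two corners, each coordinate of the displacement from [x] is dominated by that of
     [v]. *)
  apply: Hg; rewrite addrA addrK; apply: n1_mono => j; rewrite !mxE.
  have [->|jk] := eqVneq j ok; first by rewrite /= ltnn mulr1 addr0.
  by rewrite mulr0 add0r; case: ifP => // _; rewrite normr0.
rewrite mulrDr; apply: le_trans (lerD H IH); apply: le_trans (ler_normD _ _).
by rewrite le_eqVlt; apply/orP; left; apply/eqP; congr (`|_|) => /=; ring.
Qed.

Lemma partial_lipschitz (f : V -> R) (g : 'I_d -> V -> R) (K : R) x y :
  (forall j x, is_derive x (ebasis R j) f (g j x)) ->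
  (forall j x, `|g j x| <= K) -> `|f x - f y| <= K * n1 (x - y).
Proof.
move=> Hf Hg.
have := @partial_taylor f g (fun=> 0) y (x - y) K Hf.
rewrite subrK big1 ?subr0; last by move=> j _; rewrite mulr0.
by apply => j z _; rewrite subr0.
Qed.

(** With [e = p - q], the function [f (z + e) - f z] of [z] has partial derivatives at most
    [K * n1 e], which controls the move from [q] to [q']. The remaining error is
    [f (q' + e) - f p'], a first-order term. *)
Lemma second_difference (f : V -> R) (g : 'I_d -> V -> R) (K : R) p q p' q' :
  (forall j x, is_derive x (ebasis R j) f (g j x)) ->
  (forall j x, `|g j x| <= K) ->
  (forall j x y, `|g j x - g j y| <= K * n1 (x - y)) ->
  `|f p - f q - (f p' - f q')|
    <= K * n1 (p - q - (p' - q')) + K * n1 (p - q) * n1 (q - q').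
Proof.
move=> Hf Hg Hgl; pose e := p - q.
have h1 : `|(f (q + e) - f q) - (f (q' + e) - f q')| <= K * n1 e * n1 (q - q').
  apply: (@partial_lipschitz (fun z => f (z + e) - f z) (fun j z => g j (z + e) - g j z)).
    move=> j z; have := is_derive_shift (Hf j (z + e)); have := Hf j z => ? ?.
    exact: is_deriveB.
  by move=> j z; rewrite (le_trans (Hgl _ _ _))// addrAC subrr add0r.
have h2 : `|f (q' + e) - f p'| <= K * n1 (e - (p' - q')).
  have -> : e - (p' - q') = q' + e - p' by rewrite opprB addrCA addrA.
  exact: (partial_lipschitz _ _ Hf Hg).
have E : f p - f q - (f p' - f q') =
   (f (q' + e) - f p') + ((f (q + e) - f q) - (f (q' + e) - f q')).
  by rewrite [q + e]addrC subrK; ring.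
by rewrite E (le_trans (ler_normD _ _))// lerD.
Qed.

End VectorCalculus.

(** * Comparison of a Euclidean norm with its terms and with their sum *)

Section SumOfSquares.
Variables (R : realType) (J : finType) (a : J -> R).
Hypothesis a_ge0 : forall j, 0 <= a j.

Lemma sqrt_sum_sq_le : Num.sqrt (\sum_j a j ^+ 2) <= \sum_j a j.
Proof.
have s0 : 0 <= \sum_j a j by apply: sumr_ge0.
rewrite -[leRHS]ger0_norm// -sqrtr_sqr ler_sqrt ?sqr_ge0// [leRHS]expr2 mulr_suml.
apply: ler_sum => j _; rewrite expr2 ler_wpM2l// (bigD1 j)//= lerDl.
exact: sumr_ge0.
Qed.

Lemma le_sqrt_sum_sq j : a j <= Num.sqrt (\sum_j a j ^+ 2).
Proof.
rewrite -[leLHS]ger0_norm// -sqrtr_sqr ler_sqrt; last by apply: sumr_ge0 => *; rewrite sqr_ge0.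
by rewrite (bigD1 j)//= lerDl; apply: sumr_ge0 => *; rewrite sqr_ge0.
Qed.

End SumOfSquares.

Lemma continuous_addf (R : realType) (U : topologicalType) (f g : U -> R) :
  continuous f -> continuous g -> continuous (fun x => f x + g x).
Proof. by move=> cf cg x; apply: cvgD; [exact: cf|exact: cg]. Qed.

Lemma continuous_mulf (R : realType) (U : topologicalType) (f g : U -> R) :
  continuous f -> continuous g -> continuous (fun x => f x * g x).
Proof. by move=> cf cg x; apply: cvgM; [exact: cf|exact: cg]. Qed.

(** * Suprema and fields with bounded derivatives *)

Section Fields.
Variables (R : realType) (d : nat).
Local Notation V := 'rV[R]_d.
Implicit Types (x y z : V) (b f th : V -> V) (xi : current R d).

Lemma supR_ub (g : V -> R) : (exists M, forall x, g x <= M) -> forall x, g x <= supR g.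
Proof.
move=> [M H] x; apply: ub_le_sup; last by exists x.
by exists M => _ [y _ <-].
Qed.

Lemma supR_le (g : V -> R) (M : R) : (forall x, g x <= M) -> supR g <= M.
Proof.
by move=> H; apply: ge_sup; [exists (g 0), 0|move=> _ [y _ <-]].
Qed.

Lemma enorm_le_supn th : bdd th -> forall x, enorm (th x) <= supn th.
Proof. by move=> H x; exact: (@supR_ub (fun x => enorm (th x))). Qed.

Lemma supn_ge0 th : bdd th -> 0 <= supn th.
Proof. by move=> H; apply: le_trans (enorm_le_supn H 0); exact: enorm_ge0. Qed.

Lemma bdd_coord th (M : R) : (forall x i, `|th x ord0 i| <= M) -> bdd th.
Proof. by move=> H; exists (d%:R * M) => x; exact: enorm_le. Qed.

Lemma bdd_coordP th : bdd th -> exists M, forall x i, `|th x ord0 i| <= M.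
Proof. by move=> [M H]; exists M => x i; apply: le_trans (H x); exact: coord_le_enorm. Qed.

Lemma bddB f g : bdd f -> bdd g -> bdd (fun x => f x - g x).
Proof.
move=> /bdd_coordP[M H] /bdd_coordP[N H']; apply: (@bdd_coord _ (M + N)) => x i.
by rewrite !mxE (le_trans (ler_normB _ _))// lerD.
Qed.

(** The coordinatewise form in which a [C2norm] bound is used: second derivatives appear as a
    Lipschitz constant of the first ones. *)
Definition regular (K : R) b :=
  [/\ forall j x, derivable b x (ebasis R j),
      forall x i, `|b x ord0 i| <= K,
      forall j x i, `|pd b j x ord0 i| <= K &
      forall j x y i, `|pd b j x ord0 i - pd b j y ord0 i| <= K * n1 (x - y)].

Lemma derivable_is_derive b x (e : V) i : derivable b x e ->
  is_derive x e (fun x => b x ord0 i) (derive b x e ord0 i).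
Proof. by move=> H; apply: is_derive_coord; exact: DeriveDef. Qed.

Lemma bdd_choice (J : finType) (f : J -> V -> V) : (forall j, bdd (f j)) ->
  exists M : J -> R, forall j x, enorm (f j x) <= M j.
Proof.
by move=> H; exists (fun j => sval (cid (H j))) => j; exact: (svalP (cid (H j))).
Qed.

Lemma Cb2_regular b (K : R) : Cb2 b -> C2norm b <= K -> regular K b.
Proof.
move=> [[[_ [db _]] C1pd] [bb [b1 b2]]] HK.
(* A real [sup] dominates its set only if the set is bounded; the boundedness clauses of [Cb2]
   ensure this for the three summands of [C2norm]. *)
have s1 x : enorm (b x) <= supn b := enorm_le_supn bb x.
have [M1 HM1] := bdd_choice b1.
have [M2 HM2] := bdd_choice (fun jk : 'I_d * 'I_d => b2 jk.1 jk.2).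
have s2 x : Dnorm b x <= supR (Dnorm b).
  apply: supR_ub; exists (\sum_j M1 j) => z.
  apply: le_trans (sqrt_sum_sq_le (fun j => enorm_ge0 _)) _.
  by apply: ler_sum.
have D2E x : D2norm b x = Num.sqrt (\sum_jk enorm (pd (pd b jk.1) jk.2 x) ^+ 2).
  by rewrite /D2norm pair_bigA.
have s3 x : D2norm b x <= supR (D2norm b).
  apply: supR_ub; exists (\sum_jk M2 jk) => z; rewrite D2E.
  apply: le_trans (sqrt_sum_sq_le (fun j => enorm_ge0 _)) _.
  by apply: ler_sum => jk _; exact: HM2.
have p1 : 0 <= supn b by exact: supn_ge0.
have p2 : 0 <= supR (Dnorm b) by apply: le_trans (s2 0); exact: sqrtr_ge0.
have p3 : 0 <= supR (D2norm b) by apply: le_trans (s3 0); exact: sqrtr_ge0.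
move: HK; rewrite /C2norm -/(supn b) => HK.
have k1 x i : `|b x ord0 i| <= K.
  by have := s1 x; have := coord_le_enorm (b x) i; lra.
have k2 j x i : `|pd b j x ord0 i| <= K.
  have := s2 x; have := coord_le_enorm (pd b j x) i.
  have := @le_sqrt_sum_sq _ _ (fun j => enorm (pd b j x)) (fun=> enorm_ge0 _) j.
  by rewrite -/(Dnorm b x); lra.
have k3 j k x i : `|pd (pd b j) k x ord0 i| <= K.
  have := s3 x; have := coord_le_enorm (pd (pd b j) k x) i.
  have := @le_sqrt_sum_sq _ _ (fun jk : 'I_d * 'I_d => enorm (pd (pd b jk.1) jk.2 x))
    (fun=> enorm_ge0 _) (j, k).
  by rewrite -D2E/=; lra.
split=> // j x y i.
apply: (@partial_lipschitz _ _ (fun x => pd b j x ord0 i) (fun k x => pd (pd b j) k x ord0 i)) => //.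
move=> k z; apply: derivable_is_derive.
by have [_ [+ _]] := C1pd j; exact.
Qed.

Section RegularField.
Variables (K : R) (b : V -> V).
Hypothesis rb : regular K b.

Let db i j x : is_derive x (ebasis R j) (fun x => b x ord0 i) (pd b j x ord0 i).
Proof. by case: rb => H _ _ _; exact: derivable_is_derive. Qed.

Lemma regular_lip x y i : `|b x ord0 i - b y ord0 i| <= K * n1 (x - y).
Proof.
case: rb => _ _ H _.
exact: (@partial_lipschitz _ _ (fun x => b x ord0 i) (fun j x => pd b j x ord0 i)).
Qed.

Lemma regular_taylor x v i : 0 <= K ->
  `|b (v + x) ord0 i - b x ord0 i - \sum_(j < d) v ord0 j * pd b j x ord0 i| <= K * n1 v * n1 v.
Proof.
move=> K0; case: rb => _ _ _ H.
apply: (@partial_taylor _ _ (fun x => b x ord0 i) (fun j x => pd b j x ord0 i)) => // j z zv.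
by rewrite (le_trans (H _ _ _ _))// ler_wpM2l.
Qed.

Lemma regular_second_difference p q p' q' i :
  `|b p ord0 i - b q ord0 i - (b p' ord0 i - b q' ord0 i)|
    <= K * n1 (p - q - (p' - q')) + K * n1 (p - q) * n1 (q - q').
Proof.
case: rb => _ _ H1 H2.
exact: (@second_difference _ _ (fun x => b x ord0 i) (fun j x => pd b j x ord0 i)).
Qed.

End RegularField.

(** * Currents, their two norms and their push-forwards *)

Lemma Cb0 : Cb (fun=> 0 : V).
Proof.
split; first exact: cst_continuous.
by apply: (@bdd_coord _ 0) => x i; rewrite mxE normr0.
Qed.

Lemma CbZD (a : R) th1 th2 : Cb th1 -> Cb th2 -> Cb (fun x => a *: th1 x + th2 x).
Proof.
move=> [c1 /bdd_coordP[M H]] [c2 /bdd_coordP[N H']]; split.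
  apply: continuous_row => i.
  have -> : (fun x => (a *: th1 x + th2 x) ord0 i) = (fun x => a * th1 x ord0 i + th2 x ord0 i).
    by apply/funext => x; rewrite !mxE.
  apply: continuous_addf; last exact: continuous_coord.
  by apply: continuous_mulf; [exact: cst_continuous|exact: continuous_coord].
apply: (@bdd_coord _ (`|a| * M + N)) => x i.
by rewrite !mxE (le_trans (ler_normD _ _))// lerD// normrM ler_wpM2l.
Qed.

Lemma isM0 xi : isM xi -> xi (fun=> 0) = 0.
Proof.
move=> [lin _]; have := lin 1 _ _ Cb0 Cb0.
have -> : (fun x : V => 1 *: 0 + 0 : V) = (fun=> 0).
  by apply/funext => x; rewrite scaler0 addr0.
by rewrite mul1r => /eqP; rewrite -subr_eq0 opprD addrA subrr sub0r oppr_eq0 => /eqP.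
Qed.

Lemma isMZ xi (a : R) th : isM xi -> Cb th -> xi (fun x => a *: th x) = a * xi th.
Proof.
move=> mxi cth; have [lin _] := mxi; have := lin a _ _ cth Cb0.
rewrite (isM0 mxi) addr0 => <-; congr xi.
by apply/funext => x; rewrite addr0.
Qed.

Lemma isMB xi th1 th2 : isM xi -> Cb th1 -> Cb th2 ->
  xi th1 - xi th2 = xi (fun x => th1 x - th2 x).
Proof.
move=> [lin _] c1 c2; have := lin (-1) _ _ c2 c1.
rewrite mulN1r addrC => <-; congr xi.
by apply/funext => x; rewrite scaleN1r addrC.
Qed.

Lemma CbB th1 th2 : Cb th1 -> Cb th2 -> Cb (fun x => th1 x - th2 x).
Proof.
move=> c1 c2; have := CbZD (-1) c2 c1.
by congr Cb; apply/funext => x; rewrite scaleN1r addrC.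
Qed.

Lemma isM_subM xi xi' : isM xi -> isM xi' -> isM (subM xi xi').
Proof.
move=> [l1 [C HC]] [l2 [C' HC']]; split.
  by move=> a th1 th2 c1 c2; rewrite /subM l1// l2//; ring.
exists (C + C') => th cth; rewrite /subM (le_trans (ler_normB _ _))// mulrDl.
by rewrite lerD ?HC ?HC'.
Qed.

Lemma isM_bound xi : isM xi -> exists2 C : R, 0 <= C & forall th (c : R), Cb th ->
  0 <= c -> (forall x, enorm (th x) <= c) -> `|xi th| <= C * c.
Proof.
move=> [_ [C HC]]; exists `|C| => // th c cth c0 H.
apply: (le_trans (HC th cth)).
have s0 : 0 <= supn th by apply: supn_ge0; case: cth.
apply: (@le_trans _ _ (`|C| * supn th)); first by rewrite ler_wpM2r// ler_norm.
by rewrite ler_wpM2l// supR_le.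
Qed.

Lemma normM_ub_ball xi th : isM xi -> Cb th -> supn th <= 1 -> `|xi th| <= normM xi.
Proof.
move=> /isM_bound[C C0 HC] cth th1; apply: ub_le_sup; last by exists th.
exists C => _ [t [ct t1] <-]; rewrite -[C]mulr1; apply: HC => // x.
by apply: le_trans t1; apply: enorm_le_supn; case: ct.
Qed.

Lemma normM_ge0 xi : isM xi -> 0 <= normM xi.
Proof.
move=> mxi; apply: le_trans (normM_ub_ball mxi Cb0 _); first exact: normr_ge0.
apply: supR_le => x; apply: (le_trans (enorm_le_n1 _)); by rewrite n10.
Qed.

Lemma enormZ (a : R) x : enorm (a *: x) = `|a| * enorm x.
Proof.
rewrite /enorm -sqrtr_sqr -sqrtrM ?sqr_ge0//; congr Num.sqrt.
by rewrite /edot mulr_sumr; apply: eq_bigr => i _; rewrite !mxE; ring.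
Qed.

(** Scaling by [c^-1] brings [th] into the unit ball, whence the strict sign of [c]. *)
Lemma normM_ub xi th (c : R) : isM xi -> Cb th -> 0 < c ->
  (forall x, enorm (th x) <= c) -> `|xi th| <= normM xi * c.
Proof.
move=> mxi cth c0 H.
have cth' : Cb (fun x => c^-1 *: th x).
  have := CbZD c^-1 cth Cb0.
  by congr Cb; apply/funext => x; rewrite addr0.
have s1 : supn (fun x => c^-1 *: th x) <= 1.
  apply: supR_le => x; rewrite enormZ gtr0_norm ?invr_gt0// mulrC ler_pdivrMr// mul1r.
  exact: H.
have := normM_ub_ball mxi cth' s1; rewrite isMZ// normrM gtr0_norm ?invr_gt0//.
by rewrite mulrC ler_pdivrMr.
Qed.

Lemma weak_ball0 : weak_ball (fun=> 0 : V).
Proof.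
split; first exact: Cb0.
exists 0, 0; split; [by []|by []|by rewrite addr0 ler01| |].
  by move=> x; apply: (le_trans (enorm_le_n1 _)); rewrite n10.
by move=> x y; rewrite subrr mul0r; apply: (le_trans (enorm_le_n1 _)); rewrite n10.
Qed.

Lemma weak_ball_bound th : weak_ball th -> forall x, enorm (th x) <= 1.
Proof. by move=> [_ [a [c [a0 c0 ac H _]]]] x; have := H x; lra. Qed.

Lemma weak_ball_lip th : weak_ball th -> forall x y i,
  `|th x ord0 i - th y ord0 i| <= n1 (x - y).
Proof.
move=> [_ [a [c [a0 c0 ac _ H]]]] x y i.
have -> : th x ord0 i - th y ord0 i = (th x - th y) ord0 i by rewrite !mxE.
apply: (le_trans (coord_le_enorm _ _)); apply: (le_trans (H x y)).
apply: (@le_trans _ _ (1 * enorm (x - y))); last by rewrite mul1r enorm_le_n1.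
by rewrite ler_wpM2r ?enorm_ge0//; lra.
Qed.

(** By this symmetry, the supremum without absolute values in [wnorm] also bounds [- xi th]. *)
Lemma weak_ballN th : weak_ball th -> weak_ball (fun x => -1 *: th x).
Proof.
move=> [cth [a [c [a0 c0 ac H H']]]]; split.
  have := CbZD (-1) cth Cb0.
  by congr Cb; apply/funext => x; rewrite addr0.
exists a, c; split=> // [x|x y]; rewrite -?scalerBr enormZ normrN normr1 mul1r //.
Qed.

Lemma wnorm_ub xi th : isM xi -> weak_ball th -> xi th <= wnorm xi.
Proof.
move=> /isM_bound[C C0 HC] wth; apply: ub_le_sup; last by exists th.
exists C => _ [t wt <-]; apply: (le_trans (ler_norm _)).
by rewrite -[C]mulr1; apply: HC => //; [case: wt|exact: weak_ball_bound].
Qed.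

Lemma wnorm_le xi (c : R) : (forall th, weak_ball th -> xi th <= c) -> wnorm xi <= c.
Proof.
move=> H; apply: ge_sup; last by move=> _ [t wt <-]; exact: H.
by exists (xi (fun=> 0)), (fun=> 0) => //; exact: weak_ball0.
Qed.

Lemma wnorm_ge0 xi : isM xi -> 0 <= wnorm xi.
Proof. by move=> mxi; have := wnorm_ub mxi weak_ball0; rewrite isM0. Qed.

Lemma wnorm_subMC xi xi' : isM xi -> isM xi' ->
  wnorm (subM xi xi') <= wnorm (subM xi' xi).
Proof.
move=> m m'; apply: wnorm_le => th wth.
have := wnorm_ub (isM_subM m' m) (weak_ballN wth).
have cth : Cb th by case: wth.
by rewrite /subM !isMZ// !mulN1r opprK addrC.
Qed.

Lemma wnorm_le_sub xi xi' : isM xi -> isM xi' ->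
  wnorm xi <= wnorm xi' + wnorm (subM xi xi').
Proof.
move=> m m'; apply: wnorm_le => th wth.
by have := wnorm_ub m' wth; have := wnorm_ub (isM_subM m m') wth; rewrite /subM; lra.
Qed.

(** [push_field] with a free matrix field, of columns [A j], in place of the Jacobian of [P]: it
    makes sense before [A] is known to be that Jacobian. *)
Definition pull (P : V -> V) (A : 'I_d -> V -> V) th : V -> V :=
  fun x => \row_(j < d) edot (th (P x)) (A j x).

Lemma pull_coord_le P (A : 'I_d -> V -> V) th (a c : R) x j : 0 <= a -> (forall i, `|A j x ord0 i| <= a) ->
  (forall y i, `|th y ord0 i| <= c) -> `|pull P A th x ord0 j| <= d%:R * (c * a).
Proof.
move=> a0 HA Ht; rewrite mxE /edot (le_trans (ler_norm_sum _ _ _))//.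
have : \sum_(i < d) `|th (P x) ord0 i * A j x ord0 i| <= \sum_(i < d) c * a.
  by apply: ler_sum => i _; rewrite normrM ler_pM.
by rewrite sumr_const card_ord mulr_natl.
Qed.

Section Pull.
Variables (xi0 : current R d) (P : V -> V) (A : 'I_d -> V -> V) (a : R).
Hypothesis mxi0 : isM xi0.
Hypothesis cP : continuous P.
Hypothesis cA : forall j, continuous (A j).
Hypothesis a_ge0 : 0 <= a.
Hypothesis bA : forall j x i, `|A j x ord0 i| <= a.

Lemma pull_enorm_le th (c : R) : (forall x, enorm (th x) <= c) ->
  forall x, enorm (pull P A th x) <= d%:R * (d%:R * (c * a)).
Proof.
move=> H x; apply: enorm_le => j; apply: pull_coord_le => // y i.
by apply: le_trans (H y); exact: coord_le_enorm.
Qed.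

Lemma pull_Cb th : Cb th -> Cb (pull P A th).
Proof.
move=> [ct [M H]]; split; last by exists (d%:R * (d%:R * (M * a))); exact: pull_enorm_le.
apply: continuous_row => j.
have -> : (fun x => pull P A th x ord0 j) =
    (fun x => \sum_(i < d) (th (P x) ord0 i * A j x ord0 i)).
  by apply/funext => x; rewrite mxE.
apply: continuous_big => [|i _]; first exact: add_continuous.
apply: continuous_mulf; last exact: continuous_coord.
move=> x; apply: (@continuous_comp _ _ _ P (fun y => th y ord0 i)); first exact: cP.
exact: (continuous_coord ct).
Qed.

Lemma isM_pull : isM (fun th => xi0 (pull P A th)).
Proof.
have [lin _] := mxi0; have [C C0 HC] := isM_bound mxi0; split.
  move=> r th1 th2 c1 c2; rewrite -lin; try exact: pull_Cb.
  congr xi0; apply/funext => x; apply/rowP => j; rewrite !mxE /edot mulr_sumr -big_split/=.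
  by apply: eq_bigr => i _; rewrite !mxE; ring.
exists (C * (d%:R * (d%:R * a))) => th cth.
have bth : bdd th by case: cth.
have := HC _ (d%:R * (d%:R * (supn th * a))) (pull_Cb cth) _ (pull_enorm_le (enorm_le_supn bth)).
have -> : C * (d%:R * (d%:R * (supn th * a))) = C * (d%:R * (d%:R * a)) * supn th by ring.
by apply; rewrite !mulr_ge0// supn_ge0.
Qed.

Lemma wnorm_pull : wnorm (fun th => xi0 (pull P A th)) <= normM xi0 * (d%:R * (d%:R * a) + 1).
Proof.
apply: wnorm_le => th wth; apply: (le_trans (ler_norm _)).
apply: normM_ub => //; first by apply: pull_Cb; case: wth.
  (* The added 1 makes the bound positive even for [d = 0], as [normM_ub] requires. *)
  by rewrite ltr_wpDl// !mulr_ge0.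
move=> x; have := pull_enorm_le (weak_ball_bound wth) x; rewrite mul1r => /le_trans; apply.
by rewrite lerDl.
Qed.

End Pull.

(** This is where the weak norm matters: a test field that is 1-Lipschitz turns [P - P'] into an
    error [D1 * a], and its bound 1 turns [A - A'] into an error [D2]. *)
Lemma wnorm_pullB (xi0 : current R d) (P P' : V -> V)
    (A A' : 'I_d -> V -> V) (a D1 D2 c : R) : isM xi0 ->
  continuous P -> continuous P' ->
  (forall j, continuous (A j)) -> (forall j, continuous (A' j)) ->
  0 <= a ->
  (forall j x i, `|A j x ord0 i| <= a) -> (forall j x i, `|A' j x ord0 i| <= a) ->
  (forall x, n1 (P x - P' x) <= D1) ->
  (forall j x i, `|A j x ord0 i - A' j x ord0 i| <= D2) ->
  0 < c -> d%:R * (d%:R * (D1 * a + D2)) <= c ->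
  wnorm (subM (fun th => xi0 (pull P A th)) (fun th => xi0 (pull P' A' th))) <= normM xi0 * c.
Proof.
move=> m cP cP' cA cA' a0 bA bA' HP HA c0 Hc.
apply: wnorm_le => th wth; have cth : Cb th by case: wth.
have k1 := pull_Cb cP cA a0 bA cth; have k2 := pull_Cb cP' cA' a0 bA' cth.
rewrite /subM isMB//; apply: (le_trans (ler_norm _)); apply: normM_ub => //.
  exact: CbB.
move=> x; apply: le_trans Hc; apply: enorm_le => j; rewrite !mxE /edot -sumrB.
rewrite (le_trans (ler_norm_sum _ _ _))//.
have -> : d%:R * (D1 * a + D2) = \sum_(i < d) (D1 * a + D2).
  by rewrite sumr_const card_ord mulr_natl.
apply: ler_sum => i _.
have -> : th (P x) ord0 i * A j x ord0 i - th (P' x) ord0 i * A' j x ord0 i =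
  (th (P x) ord0 i - th (P' x) ord0 i) * A j x ord0 i +
  th (P' x) ord0 i * (A j x ord0 i - A' j x ord0 i) by ring.
rewrite (le_trans (ler_normD _ _))// !normrM lerD//.
  by rewrite ler_pM//; apply: le_trans (HP x); exact: weak_ball_lip.
rewrite -[D2]mul1r ler_pM//; apply: le_trans (weak_ball_bound wth (P' x)).
exact: coord_le_enorm.
Qed.

(** Turns suprema into pointwise bounds; both ranges are bounded since the two fields are in
    [Cb2]. *)
Lemma standing_diff (B : current R d -> V -> V) (CB : R) xi xi' :
  Cb2 (B xi) -> Cb2 (B xi') ->
  supn (fun x => B xi x - B xi' x) <= CB -> Ddist (B xi) (B xi') <= CB ->
  (forall x i, `|B xi x ord0 i - B xi' x ord0 i| <= CB) /\
  (forall j x i, `|pd (B xi) j x ord0 i - pd (B xi') j x ord0 i| <= CB).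
Proof.
move=> [_ [b1 [d1 _]]] [_ [b2 [d2 _]]] s1 s2; split=> [x i|j x i].
  apply: le_trans s1; apply: le_trans (enorm_le_supn (bddB b1 b2) x).
  by have := coord_le_enorm (B xi x - B xi' x) i; rewrite !mxE.
apply: le_trans s2.
have [M HM] := bdd_choice (fun j => bddB (d1 j) (d2 j)).
set g := (fun x => Num.sqrt (\sum_(j < d) enorm (pd (B xi) j x - pd (B xi') j x) ^+ 2)).
have : g x <= Ddist (B xi) (B xi').
  apply: (@supR_ub g); exists (\sum_j M j) => z.
  apply: le_trans (sqrt_sum_sq_le (fun j => enorm_ge0 _)) _.
  by apply: ler_sum.
apply: le_trans; rewrite /g.
have := @le_sqrt_sum_sq _ _ (fun j => enorm (pd (B xi) j x - pd (B xi') j x)) (fun=> enorm_ge0 _) j.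
apply: le_trans.
by have := coord_le_enorm (pd (B xi) j x - pd (B xi') j x) i; rewrite !mxE.
Qed.

End Fields.

Lemma norm_sum_ord_le (R : realType) (d : nat) (F : 'I_d -> R) (c : R) :
  (forall k, `|F k| <= c) -> `|\sum_(k < d) F k| <= d%:R * c.
Proof.
move=> H; rewrite (le_trans (ler_norm_sum _ _ _))//.
have : \sum_(k < d) `|F k| <= \sum_(k < d) c by apply: ler_sum.
by rewrite sumr_const card_ord mulr_natl.
Qed.

(** The difference quotient at [h] is within [M * |h|] of [D]. *)
Lemma is_derive_of_quadratic (R : realType) (d : nat) (f : 'rV[R]_d -> R) x e (D M : R) :
  (forall h : R, `|f (h *: e + x) - f x - h * D| <= M * (`|h| * `|h|)) -> is_derive x e f D.
Proof.
move=> H.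
have cv : (fun h : R => h^-1 *: ((f \o shift x) (h *: e) - f x)) @ 0^' --> D.
  apply/cvgrPdist_le => eps eps0.
  have M0 : 0 < `|M| + 1 by rewrite ltr_wpDl.
  near=> h.
  have h0 : h != 0 by near: h; exact: nbhs_dnbhs_neq.
  have -> : D - h^-1 *: ((f \o shift x) (h *: e) - f x) =
      - (h^-1 * (f (h *: e + x) - f x - h * D)).
    rewrite /= -[h^-1 *: _]/(h^-1 * _); set a := f _ - _.
    by field.
  rewrite normrN normrM normfV ler_pdivrMl ?normr_gt0//.
  apply: (le_trans (H h)); rewrite mulrA mulrC ler_wpM2l//.
  apply: (@le_trans _ _ ((`|M| + 1) * `|h|)).
    by rewrite ler_wpM2r// (le_trans (ler_norm _))// lerDl.
  rewrite mulrC -ler_pdivlMr//; near: h; apply: dnbhs0_le; exact: divr_gt0.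
apply: DeriveDef; first by apply/cvg_ex; exists D.
by apply/cvg_lim.
Unshelve. all: by end_near. Qed.

(** * Existence: the coupled equation for the flow and its Jacobian *)

Section Existence.
Variables (R : realType) (d : nat).
Local Notation V := 'rV[R]_d.
Local Notation dR := (d%:R : R).
Variables (B : current R d -> V -> V) (CB : R).
Hypothesis CB_gt0 : 0 < CB.
Hypothesis B_Cb2 : forall xi, isM xi -> Cb2 (B xi).
Hypothesis B_bounds : forall xi xi', isM xi -> isM xi' ->
     [/\ C2norm (B xi) <= CB * (wnorm xi + 1),
         supn (fun x => B xi x - B xi' x) <= CB * wnorm (subM xi xi') &
         Ddist (B xi) (B xi') <= CB * wnorm (subM xi xi')].

Lemma B_regular xi (K : R) : isM xi -> CB * (wnorm xi + 1) <= K -> regular K (B xi).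
Proof.
move=> m HK; have [h _ _] := B_bounds m m.
by apply: Cb2_regular; [exact: B_Cb2|exact: le_trans HK].
Qed.

Lemma B_diff xi xi' (w : R) : isM xi -> isM xi' -> wnorm (subM xi xi') <= w ->
  (forall x i, `|B xi x ord0 i - B xi' x ord0 i| <= CB * w) /\
  (forall j x i, `|pd (B xi) j x ord0 i - pd (B xi') j x ord0 i| <= CB * w).
Proof.
move=> m m' Hw; have [_ h1 h2] := B_bounds m m'.
by apply: standing_diff; try exact: B_Cb2;
  [apply: (le_trans h1)|apply: (le_trans h2)]; rewrite ler_pM2l.
Qed.

(* The state of the ODE is a map together with its candidate Jacobian:
   [u (x, None, i)] is the [i]-th coordinate of the map at [x] and [u (x, Some j, i)]
   that of its [j]-th partial derivative. *)
Definition idx : Type := (V * option 'I_d * 'I_d)%type.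

Definition pos (u : idx -> R) (x : V) : V := \row_i u (x, None, i).
Definition jac (u : idx -> R) (j : 'I_d) (x : V) : V := \row_i u (x, Some j, i).

Definition id_state : idx -> R := fun p =>
  match p with (x, None, i) => x ord0 i | (x, Some j, i) => (i == j)%:R end.

Variable xi0 : current R d.
Hypothesis mxi0 : isM xi0.

Definition cur (u : idx -> R) : current R d := fun th => xi0 (pull (pos u) (jac u) th).

(** The [Some j] components are the variational equation, with [jac u] standing for the derivative
    of the flow. *)
Definition vfield (u : idx -> R) : idx -> R := fun p =>
  match p with
  | (x, None, i) => B (cur u) (pos u x) ord0 i
  | (x, Some j, i) => \sum_(k < d) pd (B (cur u)) k (pos u x) ord0 i * jac u j x ord0 k
  end.

(* For [m = normM xi0]: [Kconst] bounds the [C^2] norm of [B (cur u)], [Gconst] the vector field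
   on every constraint, [Wconst] and [Lconst] are Lipschitz constants of [cur] and [vfield]. *)
Definition Kconst (m : R) : R := CB * (m * (dR * (dR * 2) + 1) + 1).
Definition Gconst (m : R) : R := 5 * (dR + 1) * Kconst m.
Definition Wconst (m : R) : R := m * (dR * (dR * (dR * 2 + 1)) + 1).
Definition Lconst (m : R) : R := (dR + 1) * (2 * CB * Wconst m + 2 * Kconst m * dR + 2 * Kconst m).
Definition Tconst (m : R) : R := 2^-1 / (Lconst m + (dR + 1) * Gconst m).

Let m := normM xi0.
Let K := Kconst m. Let G := Gconst m. Let W := Wconst m. Let L := Lconst m. Let T := Tconst m.

Let dR0 : 0 <= dR. Proof. exact: ler0n. Qed.
Let m0 : 0 <= m. Proof. exact: normM_ge0. Qed.
Let K0 : 0 < K.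
Proof. by rewrite /K mulr_gt0// ltr_wpDl// mulr_ge0// addr_ge0// !mulr_ge0. Qed.
Let dR1 : 0 < dR + 1. Proof. exact: ltr_wpDl. Qed.
Let G0 : 0 < G.
Proof. by apply: mulr_gt0; [exact: mulr_gt0|exact: K0]. Qed.
Let W0 : 0 <= W.
Proof. by rewrite /W mulr_ge0// addr_ge0// !mulr_ge0// addr_ge0// mulr_ge0. Qed.
Let L0 : 0 <= L.
Proof.
have a1 : 0 <= CB * W by rewrite mulr_ge0// ltW.
have a2 : 0 <= K * dR by rewrite mulr_ge0// ltW.
rewrite /L /Lconst -/W -/K; apply: mulr_ge0; first exact: ltW.
by move: K0; lra.
Qed.
Let den0 : 0 < L + (dR + 1) * G.
Proof. by rewrite ltr_wpDl// mulr_gt0// ltr_wpDl. Qed.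
Lemma Tconst_gt0 : 0 < T. Proof. by rewrite /T divr_gt0. Qed.
Let T0 := Tconst_gt0.
(** The choice of [T]: the nonnegative products [T * L], [T * G] and [d * (T * G)] sum to one half,
    so each is at most one half. *)
Let TLG : T * L + T * ((dR + 1) * G) = 2^-1.
Proof. by rewrite -mulrDr /T /Tconst mulfVK// gt_eqF. Qed.
Let TL0 : 0 <= T * L. Proof. by apply: mulr_ge0 => //; exact: ltW. Qed.
Let TG0 : 0 <= T * G. Proof. by apply: ltW; exact: mulr_gt0. Qed.
Let dTG0 : 0 <= dR * (T * G). Proof. exact: mulr_ge0. Qed.
Let TL : T * L <= 2^-1. Proof. by move: TLG TG0 dTG0; lra. Qed.
Let TG : T * G <= 2^-1. Proof. by move: TLG TL0 dTG0; lra. Qed.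
Let TGd : dR * (T * G) <= 2^-1. Proof. by move: TLG TL0 TG0; lra. Qed.

(** Bounds to be integrated over a time [T] with [T * G <= 2^-1], giving bounds on the displacement
    from [id_state]. The form in [pos_taylor] vanishes at [id_state] and measures how far [jac] is
    from being the Jacobian of [pos]. *)
Inductive constraint : seq (R * idx) -> R -> Prop :=
| jac_bounded (x : V) (j i : 'I_d) : constraint [:: (1, (x, Some j, i))] G
| jac_lip (x y : V) (j i : 'I_d) :
    constraint [:: (1, (x, Some j, i)); (-1, (y, Some j, i))] (G * n1 (x - y))
| pos_lip (x y : V) (i : 'I_d) :
    constraint [:: (1, (x, None, i)); (-1, (y, None, i))] (G * n1 (x - y))
| pos_taylor (x v : V) (i : 'I_d) :
    constraint ((1, (v + x, None, i)) :: (-1, (x, None, i)) ::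
      [seq (- v ord0 j, (x, Some j, i)) | j <- enum 'I_d]) (G * (n1 v * n1 v)).

Let adm := admissible id_state constraint T.

Lemma ev_taylor_form (v x : V) i (u : idx -> R) :
  ev ((1, (v + x, None, i)) :: (-1, (x, None, i)) ::
      [seq (- v ord0 j, (x, Some j, i)) | j <- enum 'I_d]) u =
  u (v + x, None, i) - u (x, None, i) - \sum_(j < d) v ord0 j * u (x, Some j, i).
Proof.
rewrite !ev_cons /= mul1r mulN1r addrA; congr (_ + _).
rewrite /ev big_map big_enum/= -sumrN; apply: eq_bigr => j _; by rewrite mulNr.
Qed.

(** * Admissible states, and the constraints on their vector field *)

Section Admissible.
Variable u : idx -> R.
Hypothesis au : adm u.

Lemma adm_jac_bounded j x i : `|jac u j x ord0 i| <= 2.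
Proof.
have := au (jac_bounded x j i); rewrite !ev_cons !ev_nil /= !mul1r !addr0 => h.
rewrite mxE -[u _](subrK (i == j)%:R) (le_trans (ler_normD _ _))//.
have : `|(i == j)%:R : R| <= 1 by case: (i == j); rewrite ?normr1 ?normr0.
by move: TG h; lra.
Qed.

Lemma adm_jac_lip j x y i : `|jac u j x ord0 i - jac u j y ord0 i| <= n1 (x - y).
Proof.
have := au (jac_lip x y j i); rewrite !ev_cons !ev_nil /= !mul1r !mulN1r !addr0 subrr subr0.
rewrite !mxE => /le_trans; apply; rewrite mulrA ler_piMl ?n1_ge0//.
by move: TG; lra.
Qed.

(** The map [pos u] minus the identity has Lipschitz constant [d * (T * G)], at most one half. *)
Lemma adm_pos_lip x y : n1 (pos u x - pos u y) <= 2 * n1 (x - y).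
Proof.
have -> : pos u x - pos u y = (pos u x - pos u y - (x - y)) + (x - y) by rewrite subrK.
apply: (le_trans (n1D _ _)).
have : n1 (pos u x - pos u y - (x - y)) <= dR * (T * (G * n1 (x - y))).
  apply: n1_le => i; have := au (pos_lip x y i).
  by rewrite !ev_cons !ev_nil /= !mul1r !mulN1r !addr0 !mxE.
have : dR * (T * (G * n1 (x - y))) <= n1 (x - y).
  rewrite (mulrA T) mulrA ler_piMl ?n1_ge0//; by move: TGd; lra.
lra.
Qed.

Lemma adm_pos_taylor x v i :
  `|pos u (v + x) ord0 i - pos u x ord0 i - \sum_(j < d) v ord0 j * jac u j x ord0 i|
    <= n1 v * n1 v.
Proof.
have := au (pos_taylor x v i); rewrite !ev_taylor_form.
have -> : id_state (v + x, None, i) - id_state (x, None, i) -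
   \sum_(j < d) v ord0 j * id_state (x, Some j, i) = 0.
  rewrite /id_state mxE addrK (bigD1 i)//= eqxx mulr1 big1 ?addr0 ?subrr// => j ji.
  by rewrite eq_sym (negbTE ji) mulr0.
rewrite subr0 mulrA => h; rewrite !mxE; under eq_bigr do rewrite mxE.
apply: (le_trans h); rewrite ler_piMl ?mulr_ge0 ?n1_ge0//; by move: TG; lra.
Qed.

Lemma continuous_pos : continuous (pos u).
Proof.
apply: (@continuous_of_n1_lip _ _ _ 2) => x y i.
apply: le_trans (adm_pos_lip x y).
by have := coord_le_n1 (pos u x - pos u y) i; rewrite !mxE.
Qed.

Lemma continuous_jac j : continuous (jac u j).
Proof.
by apply: (@continuous_of_n1_lip _ _ _ 1) => x y i; rewrite mul1r; exact: adm_jac_lip.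
Qed.

(** Along [h *: ebasis R j] the Taylor constraint leaves a remainder quadratic in [h]. Thus two
    components that evolve as independent unknowns are tied together as map and Jacobian. *)
Lemma is_derive_pos j x : is_derive x (ebasis R j) (pos u) (jac u j x).
Proof.
apply: is_derive_row => i; apply: (@is_derive_of_quadratic _ _ _ _ _ _ 1) => h.
have := adm_pos_taylor x (h *: ebasis R j) i; rewrite n1_ebasisZ mul1r.
rewrite (bigD1 j)//= big1 ?addr0; last by move=> k kj; rewrite !mxE (negbTE kj) mulr0 mul0r.
by rewrite [(_ *: ebasis R j) _ _]mxE [ebasis _ _ _ _]mxE eqxx mulr1.
Qed.

Lemma pd_pos j : pd (pos u) j = jac u j.
Proof. by apply/funext => x; have [_] := is_derive_pos j x. Qed.

Lemma C1_pos : C1 (pos u).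
Proof.
split; first exact: continuous_pos.
split=> [j x|j]; first by have [] := is_derive_pos j x.
by rewrite pd_pos; exact: continuous_jac.
Qed.

Lemma cur_push th : cur u th = xi0 (push_field (pos u) th).
Proof.
congr xi0; apply/funext => x; apply/rowP => j; rewrite !mxE; by rewrite pd_pos.
Qed.

Lemma isM_cur : isM (cur u).
Proof.
exact: (isM_pull mxi0 continuous_pos continuous_jac (ler0n R 2) (fun j x i => adm_jac_bounded j x i)).
Qed.

Lemma regular_cur : regular K (B (cur u)).
Proof.
apply: B_regular; first exact: isM_cur.
rewrite /K /Kconst ler_pM2l// lerD2r.
exact: (wnorm_pull mxi0 continuous_pos continuous_jac (ler0n R 2) (fun j x i => adm_jac_bounded j x i)).
Qed.

Lemma vfield_pos_le x i : `|vfield u (x, None, i)| <= K.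
Proof. by have [_ + _ _] := regular_cur; exact. Qed.

Lemma vfield_jac_le x j i : `|vfield u (x, Some j, i)| <= dR * (K * 2).
Proof.
apply: norm_sum_ord_le => k; rewrite normrM.
by have [_ _ + _] := regular_cur => h; rewrite ler_pM// adm_jac_bounded.
Qed.

Lemma vfield_bounded p : `|vfield u p| <= G.
Proof.
have dK : 0 <= dR * K by rewrite mulr_ge0// ltW.
case: p => [[x [j|]] i]; rewrite /G /Gconst -/K.
  by apply: (le_trans (vfield_jac_le _ _ _)); move: K0; lra.
by apply: (le_trans (vfield_pos_le _ _)); move: K0; lra.
Qed.

Lemma vfield_jac_lip x y j i :
  `|vfield u (x, Some j, i) - vfield u (y, Some j, i)| <= G * n1 (x - y).
Proof.
have [_ _ h1 h2] := regular_cur; set n := n1 (x - y).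
have n0 : 0 <= n by exact: n1_ge0.
have Kn : 0 <= K * n by rewrite mulr_ge0// ltW.
(* The 5 is [2 * 2], from the Lipschitz constant of [pos u] and the bound on [jac u], plus 1 from
   the Lipschitz constant of [jac u]. *)
apply: (@le_trans _ _ (dR * (5 * (K * n)))); last first.
  by rewrite /G /Gconst -/K; lra.
rewrite /vfield -sumrB; apply: norm_sum_ord_le => k.
set b := B (cur u).
have -> : pd b k (pos u x) ord0 i * jac u j x ord0 k - pd b k (pos u y) ord0 i * jac u j y ord0 k
   = (pd b k (pos u x) ord0 i - pd b k (pos u y) ord0 i) * jac u j x ord0 k
     + pd b k (pos u y) ord0 i * (jac u j x ord0 k - jac u j y ord0 k) by ring.
have -> : 5 * (K * n) = K * (2 * n) * 2 + K * n by ring.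
rewrite (le_trans (ler_normD _ _))// !normrM lerD//.
  rewrite ler_pM ?adm_jac_bounded//; apply: (le_trans (h2 _ _ _ _)).
  by rewrite ler_pM2l// adm_pos_lip.
by rewrite ler_pM// adm_jac_lip.
Qed.

Lemma vfield_pos_lip x y i :
  `|vfield u (x, None, i) - vfield u (y, None, i)| <= G * n1 (x - y).
Proof.
apply: (le_trans (regular_lip regular_cur _ _ _)).
apply: (@le_trans _ _ (K * (2 * n1 (x - y)))); first by rewrite ler_pM2l// adm_pos_lip.
have n0 : 0 <= n1 (x - y) by exact: n1_ge0.
have Kn : 0 <= K * n1 (x - y) by rewrite mulr_ge0// ltW.
have dKn : 0 <= dR * (K * n1 (x - y)) by rewrite mulr_ge0.
by rewrite /G /Gconst -/K; lra.
Qed.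

(** A chain rule with remainder: Taylor's formula for [b] at [p] with increment [D] costs
    [4 * (K * (n * n))], and replacing [D] by its linear part costs [d * (K * (n * n))] by
    admissibility of [u]. *)
Lemma vfield_taylor x v i :
  `|vfield u (v + x, None, i) - vfield u (x, None, i)
    - \sum_(j < d) v ord0 j * vfield u (x, Some j, i)| <= G * (n1 v * n1 v).
Proof.
have rb := regular_cur; have [_ _ h1 _] := rb; rewrite /vfield.
set b := B (cur u); set p := pos u x; pose D := pos u (v + x) - p.
have -> : pos u (v + x) = D + p by rewrite subrK.
have nD : n1 D <= 2 * n1 v by have := adm_pos_lip (v + x) x; rewrite addrK.
have -> : b (D + p) ord0 i - b p ord0 i - \sum_(j < d) v ord0 j *
      \sum_(k < d) pd b k p ord0 i * jac u j x ord0 k =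
    (b (D + p) ord0 i - b p ord0 i - \sum_(k < d) D ord0 k * pd b k p ord0 i) +
    \sum_(k < d) (D ord0 k - \sum_(j < d) v ord0 j * jac u j x ord0 k) * pd b k p ord0 i.
  have -> : \sum_(j < d) v ord0 j * \sum_(k < d) pd b k p ord0 i * jac u j x ord0 k =
     \sum_(k < d) (\sum_(j < d) v ord0 j * jac u j x ord0 k) * pd b k p ord0 i.
    under eq_bigr do rewrite mulr_sumr.
    rewrite exchange_big/=; apply: eq_bigr => k _; rewrite mulr_suml.
    by apply: eq_bigr => j _; ring.
  by under [X in _ = _ + X]eq_bigr do rewrite mulrBl; rewrite sumrB; ring.
set n := n1 v in nD *; have n0 : 0 <= n by exact: n1_ge0.
have nn0 : 0 <= n * n by rewrite mulr_ge0.
have Knn : 0 <= K * (n * n) by rewrite mulr_ge0// ltW.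
have dKnn : 0 <= dR * (K * (n * n)) by rewrite mulr_ge0.
have g1 : `|b (D + p) ord0 i - b p ord0 i - \sum_(k < d) D ord0 k * pd b k p ord0 i|
    <= 4 * (K * (n * n)).
  apply: (le_trans (regular_taylor rb p D i (ltW K0))); rewrite -mulrA.
  have -> : 4 * (K * (n * n)) = K * ((2 * n) * (2 * n)) by ring.
  by rewrite ler_pM2l// ler_pM// n1_ge0.
have g2 : `|\sum_(k < d) (D ord0 k - \sum_(j < d) v ord0 j * jac u j x ord0 k) * pd b k p ord0 i|
    <= dR * (K * (n * n)).
  apply: norm_sum_ord_le => k; rewrite normrM mulrC ler_pM//.
  by have := adm_pos_taylor x v k; rewrite /D !mxE.
apply: (le_trans (ler_normD _ _)); move: g1 g2; rewrite /G /Gconst -/K; lra.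
Qed.

Lemma vfield_constraint s c : constraint s c -> `|ev s (vfield u)| <= c.
Proof.
case=> [x j i|x y j i|x y i|x v i].
- by rewrite ev_cons ev_nil addr0 mul1r; exact: vfield_bounded.
- by rewrite !ev_cons ev_nil addr0 mul1r mulN1r; exact: vfield_jac_lip.
- by rewrite !ev_cons ev_nil addr0 mul1r mulN1r; exact: vfield_pos_lip.
- by rewrite ev_taylor_form; exact: vfield_taylor.
Qed.

End Admissible.

(** * Lipschitz dependence of the vector field on the state *)

Section TwoStates.
Variables (u v : idx -> R) (D : R).
Hypotheses (au : adm u) (av : adm v) (D0 : 0 < D).
Hypothesis uvD : forall p, `|u p - v p| <= D.

Lemma pos_dist x : n1 (pos u x - pos v x) <= dR * D.
Proof. by apply: n1_le => i; rewrite !mxE. Qed.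

Lemma jac_dist j x i : `|jac u j x ord0 i - jac v j x ord0 i| <= D.
Proof. by rewrite !mxE. Qed.

Lemma cur_dist : wnorm (subM (cur u) (cur v)) <= W * D.
Proof.
rewrite /W /Wconst -mulrA.
apply: (wnorm_pullB mxi0 (continuous_pos au) (continuous_pos av)
  (continuous_jac au) (continuous_jac av) (ler0n R 2)
  (fun j x i => adm_jac_bounded au j x i) (fun j x i => adm_jac_bounded av j x i)
  pos_dist jac_dist).
  by rewrite mulr_gt0// ltr_wpDl// !mulr_ge0// addr_ge0// mulr_ge0.
by move: D0; lra.
Qed.

(** Up to three changes are made one at a time: the current inside [B], the point of evaluation, and
    the Jacobian factor. *)
Lemma vfield_lip p : `|vfield u p - vfield v p| <= L * D.
Proof.
have [d1 d2] := B_diff (isM_cur au) (isM_cur av) cur_dist.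
have rv := regular_cur av; have [_ _ h1 h2] := rv.
have WD : 0 <= CB * (W * D) by rewrite !mulr_ge0// ltW.
have KD : 0 <= K * D by rewrite mulr_ge0// ltW.
have dKD : 0 <= dR * (K * D) by rewrite mulr_ge0.
have dWD : 0 <= dR * (CB * (W * D)) by rewrite mulr_ge0.
have ddKD : 0 <= dR * (dR * (K * D)) by rewrite mulr_ge0.
have LE : L * D = (dR + 1) * (2 * (CB * (W * D)) + 2 * (dR * (K * D)) + 2 * (K * D)).
  by rewrite /L /Lconst -/W -/K; ring.
case: p => [[x [j|]] i]; rewrite /vfield; last first.
  have e1 := d1 (pos u x) i.
  have e2 : `|B (cur v) (pos u x) ord0 i - B (cur v) (pos v x) ord0 i| <= dR * (K * D).
    apply: (le_trans (regular_lip rv _ _ _)).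
    by rewrite mulrCA ler_pM2l// pos_dist.
  rewrite -(subrK (B (cur v) (pos u x) ord0 i) (B (cur u) (pos u x) ord0 i)) -addrA.
  by apply: (le_trans (ler_normD _ _)); rewrite LE; lra.
rewrite -sumrB.
apply: (@le_trans _ _ (dR * (CB * (W * D) * 2 + dR * (K * D) * 2 + K * D))); last first.
  by rewrite LE; lra.
apply: norm_sum_ord_le => k.
set a := pd (B (cur u)) k (pos u x) ord0 i; set a2 := pd (B (cur v)) k (pos v x) ord0 i.
set a1 := pd (B (cur v)) k (pos u x) ord0 i.
have -> : a * jac u j x ord0 k - a2 * jac v j x ord0 k =
  (a - a1) * jac u j x ord0 k + (a1 - a2) * jac u j x ord0 k
   + a2 * (jac u j x ord0 k - jac v j x ord0 k) by ring.
rewrite (le_trans (ler_normD _ _))// lerD//; last first.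
  by rewrite normrM; apply: ler_pM => //; [exact: h1|exact: jac_dist].
rewrite (le_trans (ler_normD _ _))// lerD// normrM; apply: ler_pM => //; try exact: adm_jac_bounded.
  exact: d2.
by apply: (le_trans (h2 _ _ _ _)); rewrite mulrCA ler_pM2l// pos_dist.
Qed.

End TwoStates.

Lemma constraint_ge0 s c : constraint s c -> 0 <= c.
Proof. have G0' := ltW G0; case=> [_ _ _|x y _ _|x y _|_ v _] //.
- by apply: mulr_ge0 => //; exact: n1_ge0.
- by apply: mulr_ge0 => //; exact: n1_ge0.
- by apply: mulr_ge0 => //; apply: mulr_ge0; exact: n1_ge0. Qed.

Lemma flow_exists : exists xi : R -> current R d, flow_solution B xi0 T xi.
Proof.
have [u [u_0 u_adm u_lip u_der]] := @picard R idx id_state vfield constraint T L G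
  T0 G0 L0 TL constraint_ge0 vfield_constraint vfield_bounded
  (fun u v D au av D0 H => vfield_lip au av D0 H).
exists (fun t => cur (u t)); split; first by move=> t _; exact: (isM_cur (u_adm t)).
split.
  move=> t _ eps eps0.
  have W1 : 0 < W + 1 by rewrite ltr_wpDl.
  (* The state is [G]-Lipschitz in time and the current [W]-Lipschitz in the state; [W + 1] stands
     in for [W], which may vanish. *)
  exists (eps / ((W + 1) * G)); first by rewrite divr_gt0// mulr_gt0.
  move=> s _ st.
  have D0 : 0 < eps / (W + 1) by rewrite divr_gt0.
  apply: (@le_lt_trans _ _ (W * (eps / (W + 1)))).
    apply: (cur_dist (u_adm s) (u_adm t)) => // p; apply: (le_trans (u_lip p s t)).
    rewrite mulrC -ler_pdivlMr//; apply/ltW; apply: (lt_le_trans st).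
    by rewrite invfM mulrA.
  by rewrite mulrCA gtr_pMr// ltr_pdivrMr// mul1r ltrDl.
exists (fun t => pos (u t)); split.
- split; first by move=> x; apply/rowP => i; rewrite mxE u_0.
  split=> [x|x t tT].
    apply: continuous_subspaceT; apply: continuous_row => i.
    by apply: (@continuous_of_lipschitz _ _ G) => s t; rewrite !mxE.
  have : is_derive t 1 (fun s => pos (u s) x) (B (cur (u t)) (pos (u t) x)).
    apply: is_derive_row => i; have := u_der (x, None, i) t tT.
    by congr is_derive; apply/funext => s; rewrite mxE.
  by case=> ? ?; split.
- by move=> t _; exact: (C1_pos (u_adm t)).
- by move=> t _ th _; exact: (cur_push (u_adm t)).
Qed.

End Existence.

(** * Gronwall's inequality with exponential weights *)

Section Gronwall.
Variables (R : realType) (d : nat).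
Local Notation V := 'rV[R]_d.
Local Notation dR := (d%:R : R).

Lemma is_derive_expR_scale (c la t : R) :
  is_derive t 1 (fun s => c * expR (la * s)) (c * la * expR (la * t)).
Proof.
have h1 : is_derive t (1 : R) (fun s : R => la * s) la.
  have := is_deriveZ la (is_derive_id t (1 : R)).
  by rewrite /GRing.scale/= mulr1.
have := is_deriveZ c (is_derive1_comp (is_derive_expR (la * t)) h1).
by move=> /is_derive_eq; apply; rewrite /GRing.scale/=; ring.
Qed.

(* Gronwall's inequality in Bielecki form: measuring [y] in the norm
   [sup_t |y t| exp (- la t)], the growth term [L * n1 (y t)] costs at most one half
   of the norm as soon as [la >= 2 d L]. *)
Lemma gronwall_bielecki (y y' : R -> V) (T L eps la a : R) :
  0 <= L -> 0 <= eps -> 0 <= a -> 0 < la -> 2 * (dR * L) <= la -> 0 <= T ->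
  (forall i, {within `[0, T], continuous (fun t => y t ord0 i)}) ->
  (forall i t, 0 < t < T -> is_derive t 1 (fun t => y t ord0 i) (y' t ord0 i)) ->
  (forall i t, 0 < t < T -> `|y' t ord0 i| <= L * n1 (y t) + eps * expR (la * t)) ->
  (forall i, `|y 0 ord0 i| <= a) ->
  forall t i, 0 <= t <= T -> `|y t ord0 i| <= (2 * a + 2 * eps / la) * expR (la * t).
Proof.
move=> L0 eps0 a0 la0 Lla T0 cy dy hy ya.
have dR0 : 0 <= dR by exact: ler0n.
have e1 t : 0 <= t -> 1 <= expR (la * t).
  by move=> t0; rewrite -expR0 ler_expR mulr_ge0// ltW.
(* A first finite bound, by compactness; the iteration makes its contribution vanish. *)
have [N N0 HN] : exists2 N, 0 <= N & forall t i, 0 <= t <= T -> `|y t ord0 i| <= N.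
  have cn : {within `[0, T], continuous (fun t => n1 (y t))}.
    apply: continuous_big => [|i _]; first exact: add_continuous.
    move=> x; apply: (@continuous_comp _ _ _ _ (fun r : R => `|r|)); first exact: cy.
    exact: norm_continuous.
  have [c _ Hc] := EVT_max T0 cn.
  exists (n1 (y c)); first exact: n1_ge0.
  move=> t i tT; apply: (le_trans (coord_le_n1 _ _)); apply: Hc.
  by rewrite in_itv.
pose b := a + eps / la.
(* Integrating the differential inequality once turns the bound [M] into [M / 2 + b]; the factor one
   half comes from [2 * (dR * L) <= la]. *)
have step M : 0 <= M -> (forall t i, 0 <= t <= T -> `|y t ord0 i| <= M * expR (la * t)) ->
    forall t i, 0 <= t <= T -> `|y t ord0 i| <= (M / 2 + b) * expR (la * t).
  move=> M0 H t i /andP[t0 tT].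
  pose c := (dR * L * M + eps) / la.
  have h : `|y t ord0 i - y 0 ord0 i| <= c * expR (la * t) - c * expR (la * 0).
    apply: (@norm_sub_le_derive _ (fun t => y t ord0 i) (fun s => c * expR (la * s))
        (fun t => y' t ord0 i) (fun s => c * la * expR (la * s))) => //.
    - by move=> x /andP[x0 xt]; apply: dy; rewrite x0 (lt_le_trans xt).
    - by move=> x _; exact: is_derive_expR_scale.
    - apply: continuous_subspaceW (cy i) => x /=; rewrite !in_itv/= => /andP[-> xt].
      exact: le_trans tT.
    - apply: (@within_continuous_derive _ _ (fun s => c * la * expR (la * s))) => x _.
      exact: is_derive_expR_scale.
    - move=> x /andP[x0 xt]; have xT : x < T := lt_le_trans xt tT.
      apply: (le_trans (hy i x _)); first by rewrite x0.
      rewrite /c divfK ?gt_eqF// mulrDl lerD2r.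
      have -> : dR * L * M * expR (la * x) = L * (dR * (M * expR (la * x))) by ring.
      rewrite ler_wpM2l//; apply: n1_le => k; apply: H.
      by rewrite (ltW x0) (ltW xT).
  have c1 : c <= M / 2 + eps / la.
    rewrite /c mulrDl lerD2r ler_pdivrMr//.
    by have := ler_wpM2r M0 Lla; lra.
  have e0 := e1 t t0.
  have h2 : `|y t ord0 i| <= a + c * (expR (la * t) - 1).
    rewrite -(subrK (y 0 ord0 i) (y t ord0 i)) (le_trans (ler_normD _ _))//.
    by have := ya i; move: h; rewrite mulr0 expR0; lra.
  apply: (le_trans h2).
  have c0 : 0 <= c by rewrite /c divr_ge0 ?addr_ge0 ?mulr_ge0// ltW.
  have h3 : a <= a * expR (la * t) by rewrite ler_peMr.
  have h4 : c * expR (la * t) <= (M / 2 + eps / la) * expR (la * t).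
    by rewrite ler_wpM2r// expR_ge0.
  by rewrite /b; lra.
have b0 : 0 <= b by rewrite addr_ge0// divr_ge0// ltW.
(* [2 * b] is the fixed point of the passage from [M] to [M / 2 + b], and the gap to it halves each
   time. *)
have iter n t i : 0 <= t <= T -> `|y t ord0 i| <= (2 * b + N / 2 ^+ n) * expR (la * t).
  elim: n t i => [|n IH] t i tT.
    rewrite expr0 divr1; apply: (le_trans (HN t i tT)).
    have /andP[/e1 e0 _] := tT.
    by rewrite (@le_trans _ _ (2 * b + N))// ?ler_peMr ?lerDr ?addr_ge0 ?mulr_ge0.
  have -> : 2 * b + N / 2 ^+ n.+1 = (2 * b + N / 2 ^+ n) / 2 + b.
    by rewrite exprS invfM; field; rewrite expf_neq0.
  apply: step => //.
  by rewrite addr_ge0 ?mulr_ge0 ?invr_ge0 ?exprn_ge0.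
move=> t i tT.
apply: (@le_of_dyadic _ _ _ (N * expR (la * t))) => n.
apply: (le_trans (iter n t i tT)); rewrite le_eqVlt; apply/orP; left; apply/eqP.
by rewrite /b; field; rewrite expf_neq0//= gt_eqF.
Qed.

(** The difference quotients are bounded by [c] and tend to [D]. Bounds on Jacobians of flows thus
    follow from Lipschitz bounds, with no equation for the Jacobian. *)
Lemma derive_le_lipschitz (f : V -> R) x e (D c : R) : is_derive x e f D ->
  (forall h : R, `|f (h *: e + x) - f x| <= c * `|h|) -> `|D| <= c.
Proof.
move=> [df Df] H; apply/ler_addgt0Pr => eps eps0.
have cv : (fun h : R => h^-1 *: ((f \o shift x) (h *: e) - f x)) @ 0^' --> D.
  by rewrite -Df; exact: df.
near (0 : R)^' => h.
have h0 : h != 0 by near: h; exact: nbhs_dnbhs_neq.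
have q1 : `|D - h^-1 *: ((f \o shift x) (h *: e) - f x)| <= eps.
  by near: h; move/cvgrPdist_le: cv; exact.
have q2 : `|h^-1 *: ((f \o shift x) (h *: e) - f x)| <= c.
  rewrite -[h^-1 *: _]/(h^-1 * _) normrM normfV ler_pdivrMl ?normr_gt0// mulrC.
  exact: H.
rewrite -(subrK (h^-1 *: ((f \o shift x) (h *: e) - f x)) D).
by rewrite (le_trans (ler_normD _ _))// addrC lerD.
Unshelve. all: by end_near. Qed.

Lemma within_continuous_coordB (A : set R) (f g : R -> V) i :
  {within A, continuous (fun t => f t ord0 i)} -> {within A, continuous (fun t => g t ord0 i)} ->
  {within A, continuous (fun t => (f t - g t) ord0 i)}.
Proof.
move=> cf cg; have -> : (fun t => (f t - g t) ord0 i) = (fun t => f t ord0 i - g t ord0 i).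
  by apply/funext => t; rewrite !mxE.
by move=> t; apply: cvgB; [exact: cf|exact: cg].
Qed.

Lemma is_derive_coordB (f g : R -> V) (u v : V) (t : R) i :
  is_derive t 1 (fun t => f t ord0 i) (u ord0 i) -> is_derive t 1 (fun t => g t ord0 i) (v ord0 i) ->
  is_derive t 1 (fun t => (f t - g t) ord0 i) ((u - v) ord0 i).
Proof.
move=> df dg; have -> : (fun t => (f t - g t) ord0 i) = (fun t => f t ord0 i - g t ord0 i).
  by apply/funext => s; rewrite !mxE.
by rewrite !mxE; exact: is_deriveB.
Qed.

End Gronwall.

(** * Uniqueness: estimates on two flows *)

Section Uniqueness.
Variables (R : realType) (d : nat).
Local Notation V := 'rV[R]_d.
Local Notation dR := (d%:R : R).
Variables (B : current R d -> V -> V) (CB T : R).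
Hypothesis CB_gt0 : 0 < CB.
Hypothesis T_gt0 : 0 < T.
Hypothesis B_Cb2 : forall xi, isM xi -> Cb2 (B xi).
Hypothesis B_bounds : forall xi xi', isM xi -> isM xi' ->
     [/\ C2norm (B xi) <= CB * (wnorm xi + 1),
         supn (fun x => B xi x - B xi' x) <= CB * wnorm (subM xi xi') &
         Ddist (B xi) (B xi') <= CB * wnorm (subM xi xi')].

(** By the triangle inequality the weak norm is continuous along the curve, hence bounded on a
    compact interval. This yields one constant [K] for all the fields [B (xi t)]. *)
Lemma wnorm_bounded (xi : R -> current R d) :
  (forall t, 0 <= t <= T -> isM (xi t)) ->
  (forall t, 0 <= t <= T -> forall eps : R, 0 < eps -> exists2 delta : R, 0 < delta &
     forall s, 0 <= s <= T -> `|s - t| < delta -> wnorm (subM (xi s) (xi t)) < eps) ->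
  exists M, forall t, 0 <= t <= T -> wnorm (xi t) <= M.
Proof.
move=> mxi cxi.
have cw : {within `[0, T], continuous (fun t => wnorm (xi t))}.
  apply/subspace_continuousP => t /=; rewrite in_itv/= => tT.
  apply/cvgrPdist_lt => eps eps0.
  have [delta delta0 H] := cxi t tT eps eps0.
  have nb : \forall s \near t, `|s - t| < delta.
    near=> s; rewrite distrC; near: s.
    by apply: (@cvgr_dist_lt _ R _ _ _ id) => //; exact: cvg_id.
  apply: filterS nb => s st /=; rewrite in_itv/= => sT.
  have := H s sT st.
  have := wnorm_le_sub (mxi s sT) (mxi t tT); have := wnorm_le_sub (mxi t tT) (mxi s sT).
  have := wnorm_subMC (mxi t tT) (mxi s sT).
  by move=> ? ? ? ?; rewrite /from_subspace/= ltr_norml; apply/andP; split; lra.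
have [c _ Hc] := EVT_max (ltW T_gt0) cw.
by exists (wnorm (xi c)) => t tT; apply: Hc; rewrite in_itv.
Unshelve. all: by end_near. Qed.

Lemma flow_continuous xi phi x i : is_flow B xi T phi ->
  {within `[0, T], continuous (fun s => phi s x ord0 i)}.
Proof. by move=> [_ [c _]]; apply: (@continuous_coord _ _ (subspace `[0, T])); exact: c. Qed.

Lemma flow_derive xi phi x i t : is_flow B xi T phi -> 0 < t < T ->
  is_derive t 1 (fun s => phi s x ord0 i) (B (xi t) (phi t x) ord0 i).
Proof.
move=> [_ [_ H]] tT; have [df Df] := H x t tT.
by apply: (@is_derive_coord _ _ _ (fun s => phi s x)); rewrite -Df; exact: DeriveDef.
Qed.

Variables (xi xi' : R -> current R d) (phi phi' : R -> V -> V) (K : R).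
Hypothesis mxi : forall t, 0 <= t <= T -> isM (xi t).
Hypothesis mxi' : forall t, 0 <= t <= T -> isM (xi' t).
Hypothesis K_ge0 : 0 <= K.
Hypothesis rxi : forall t, 0 <= t <= T -> regular K (B (xi t)).
Hypothesis rxi' : forall t, 0 <= t <= T -> regular K (B (xi' t)).
Hypothesis fphi : is_flow B xi T phi.
Hypothesis fphi' : is_flow B xi' T phi'.

Let dR0 : 0 <= dR. Proof. exact: ler0n. Qed.

Let oc t : 0 < t < T -> 0 <= t <= T.
Proof. by move=> /andP[/ltW -> /ltW ->]. Qed.

(** The factor given by [gronwall_bielecki] at time [T] without forcing; the [+ 1] keeps the rate
    positive. *)
Definition lip_const (K' : R) : R := 2 * expR ((2 * (dR * K') + 1) * T).

Lemma flow_lip x z t i : 0 <= t <= T ->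
  `|phi t x ord0 i - phi t z ord0 i| <= lip_const K * n1 (x - z).
Proof.
move=> tT; pose la := 2 * (dR * K) + 1.
have la0 : 0 < la by rewrite ltr_wpDl// mulr_ge0// mulr_ge0.
have := @gronwall_bielecki _ _ (fun t => phi t x - phi t z)
  (fun t => B (xi t) (phi t x) - B (xi t) (phi t z)) T K 0 la (n1 (x - z)).
move=> /(_ K_ge0 (lexx _) (n1_ge0 _) la0 _ (ltW T_gt0) _ _ _ _ t i tT).
rewrite mulr0 mul0r addr0 !mxE => H.
have {H} : `|phi t x ord0 i - phi t z ord0 i| <= 2 * n1 (x - z) * expR (la * t).
  apply: H.
  - by rewrite lerDl.
  - by move=> k; apply: within_continuous_coordB; exact: flow_continuous fphi.
  - by move=> k s sT; apply: is_derive_coordB; exact: flow_derive fphi sT.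
  - move=> k s sT; rewrite !mxE mul0r addr0.
    exact: (regular_lip (rxi (oc sT))).
  - by move=> k; have [p0 _] := fphi; rewrite !p0 coord_le_n1.
move=> /le_trans; apply; rewrite /lip_const -/la mulrAC ler_wpM2r ?n1_ge0// ler_pM2l//.
by rewrite ler_expR ler_pM2l//; case/andP: tT.
Qed.

Lemma flow_n1_lip x z t : 0 <= t <= T ->
  n1 (phi t x - phi t z) <= dR * (lip_const K * n1 (x - z)).
Proof. by move=> tT; apply: n1_le => i; rewrite !mxE; exact: flow_lip. Qed.

Lemma pd_flow_le t j x i : 0 <= t <= T -> C1 (phi t) ->
  `|pd (phi t) j x ord0 i| <= lip_const K.
Proof.
move=> tT [_ [df _]].
apply: (derive_le_lipschitz (derivable_is_derive i (df j x))) => h.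
apply: (le_trans (flow_lip _ _ _ tT)); by rewrite addrK n1_ebasisZ.
Qed.

(** * Distance between the flows and between their Jacobians *)

Section Distance.
Variables (eps la : R).
Hypothesis eps_ge0 : 0 <= eps.
Hypothesis la_ge1 : 1 <= la.
Hypothesis K_la : 2 * (dR * K) <= la.
Hypothesis xi_dist : forall t, 0 <= t <= T ->
  wnorm (subM (xi t) (xi' t)) <= eps * expR (la * t).

Let la0 : 0 < la. Proof. exact: lt_le_trans la_ge1. Qed.

(** The velocities are compared through [B (xi' s) (phi s x)]: the change of field is the forcing
    term and the change of point the growth term. The factor [1 / la] is the gain that closes the
    uniqueness argument. *)
Lemma flow_dist x t i : 0 <= t <= T ->
  `|phi t x ord0 i - phi' t x ord0 i| <= 2 * (CB * eps) / la * expR (la * t).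
Proof.
move=> tT.
have ce : 0 <= CB * eps by rewrite mulr_ge0// ltW.
have := @gronwall_bielecki _ _ (fun t => phi t x - phi' t x)
  (fun t => B (xi t) (phi t x) - B (xi' t) (phi' t x)) T K (CB * eps) la 0.
move=> /(_ K_ge0 ce (lexx _) la0 K_la (ltW T_gt0) _ _ _ _ t i tT).
rewrite mulr0 add0r !mxE; apply.
- move=> k; apply: within_continuous_coordB.
    exact: flow_continuous fphi.
  exact: flow_continuous fphi'.
- move=> k s sT; apply: is_derive_coordB.
    exact: flow_derive fphi sT.
  exact: flow_derive fphi' sT.
- move=> k s sT; rewrite !mxE; have sT' := oc sT.
  have [h1 _] := B_diff CB_gt0 B_Cb2 B_bounds (mxi sT') (mxi' sT') (xi_dist sT').
  have := h1 (phi s x) k; have := regular_lip (rxi' sT') (phi s x) (phi' s x) k => g1 g2.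
  rewrite -(subrK (B (xi' s) (phi s x) ord0 k) (B (xi s) (phi s x) ord0 k)) -addrA.
  by apply: (le_trans (ler_normD _ _)); move: g1 g2; lra.
- move=> k; have [p0 _] := fphi; have [p0' _] := fphi'.
  by rewrite p0 p0' subrr mxE normr0.
Qed.

(** The first term comes from the difference of the derivatives of [B (xi s)] and [B (xi' s)], the
    second from the product term of [regular_second_difference]. *)
Definition diff_const : R :=
  CB * (dR * lip_const K) + K * (dR * lip_const K) * (dR * (2 * CB)).

(** Gronwall for the second difference: at the points of [phi] the field is changed from [B (xi s)]
    to [B (xi' s)], then the points themselves are changed for this fixed field. *)
Lemma flow_diff_lip x z t i : 0 <= t <= T ->
  `|phi t x ord0 i - phi t z ord0 i - (phi' t x ord0 i - phi' t z ord0 i)|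
   <= 2 * (eps * (diff_const * n1 (x - z))) / la * expR (la * t).
Proof.
move=> tT; set n := n1 (x - z).
have n0 : 0 <= n by exact: n1_ge0.
have E0 : 0 <= lip_const K by rewrite /lip_const mulr_ge0// expR_ge0.
have dE0 : 0 <= dR * lip_const K by rewrite mulr_ge0.
have CB0 := ltW CB_gt0.
have dc0 : 0 <= diff_const by rewrite /diff_const addr_ge0// !mulr_ge0.
have e0 : 0 <= eps * (diff_const * n) by rewrite !mulr_ge0.
have := @gronwall_bielecki _ _ (fun t => phi t x - phi t z - (phi' t x - phi' t z))
  (fun t => B (xi t) (phi t x) - B (xi t) (phi t z)
            - (B (xi' t) (phi' t x) - B (xi' t) (phi' t z))) T K (eps * (diff_const * n)) la 0.
move=> /(_ K_ge0 e0 (lexx _) la0 K_la (ltW T_gt0) _ _ _ _ t i tT).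
rewrite mulr0 add0r !mxE; apply.
- move=> k; apply: (@within_continuous_coordB _ _ _ (fun t => phi t x - phi t z)
    (fun t => phi' t x - phi' t z)); apply: within_continuous_coordB.
  + exact: flow_continuous fphi.
  + exact: flow_continuous fphi.
  + exact: flow_continuous fphi'.
  + exact: flow_continuous fphi'.
- move=> k s sT; apply: (@is_derive_coordB _ _ (fun t => phi t x - phi t z)
    (fun t => phi' t x - phi' t z)); apply: is_derive_coordB.
  + exact: flow_derive fphi sT.
  + exact: flow_derive fphi sT.
  + exact: flow_derive fphi' sT.
  + exact: flow_derive fphi' sT.
- move=> k s sT; rewrite !mxE; have sT' := oc sT.
  set p := phi s x; set q := phi s z; set p' := phi' s x; set q' := phi' s z.
  have [_ h1] := B_diff CB_gt0 B_Cb2 B_bounds (mxi sT') (mxi' sT') (xi_dist sT').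
  have pq : n1 (p - q) <= dR * (lip_const K * n) by exact: flow_n1_lip.
  (* The [1 / la] of [flow_dist] is dropped here, using [1 <= la], so that [diff_const] is
     independent of [la]; Gronwall supplies a new one. *)
  have qq : n1 (q - q') <= dR * (2 * (CB * eps) * expR (la * s)).
    apply: n1_le => l; rewrite !mxE; apply: (le_trans (flow_dist _ _ sT')).
    rewrite ler_wpM2r ?expR_ge0// ler_pdivrMr// ler_peMr// mulr_ge0// mulr_ge0//.
  have es : 0 <= expR (la * s) by exact: expR_ge0.
  have g1 : `|(B (xi s) p ord0 k - B (xi' s) p ord0 k) - (B (xi s) q ord0 k - B (xi' s) q ord0 k)|
      <= CB * (eps * expR (la * s)) * n1 (p - q).
    have [db _ _ _] := rxi sT'; have [db' _ _ _] := rxi' sT'.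
    apply: (@partial_lipschitz _ _ (fun y => B (xi s) y ord0 k - B (xi' s) y ord0 k)
      (fun j y => pd (B (xi s)) j y ord0 k - pd (B (xi' s)) j y ord0 k)) => // j y.
    have := derivable_is_derive k (db j y); have := derivable_is_derive k (db' j y) => ? ?.
    exact: is_deriveB.
  have g2 := regular_second_difference (rxi' sT') p q p' q' k.
  have k1 : CB * (eps * expR (la * s)) * n1 (p - q) <=
      CB * (eps * expR (la * s)) * (dR * (lip_const K * n)).
    by rewrite ler_wpM2l// !mulr_ge0.
  have k2 : K * n1 (p - q) * n1 (q - q') <=
      K * (dR * (lip_const K * n)) * (dR * (2 * (CB * eps) * expR (la * s))).
    by rewrite ler_pM ?mulr_ge0 ?n1_ge0// ler_wpM2l.
  have -> : B (xi s) p ord0 k - B (xi s) q ord0 k - (B (xi' s) p' ord0 k - B (xi' s) q' ord0 k) =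
    ((B (xi s) p ord0 k - B (xi' s) p ord0 k) - (B (xi s) q ord0 k - B (xi' s) q ord0 k)) +
    (B (xi' s) p ord0 k - B (xi' s) q ord0 k - (B (xi' s) p' ord0 k - B (xi' s) q' ord0 k)).
    by ring.
  apply: (le_trans (ler_normD _ _)).
  have -> : eps * (diff_const * n) * expR (la * s) =
      CB * (eps * expR (la * s)) * (dR * (lip_const K * n)) +
      K * (dR * (lip_const K * n)) * (dR * (2 * (CB * eps) * expR (la * s))).
    by rewrite /diff_const; ring.
  by move: g1 g2 k1 k2; lra.
- move=> k; have [p0 _] := fphi; have [p0' _] := fphi'.
  by rewrite !p0 !p0' subrr mxE normr0.
Qed.

Lemma pd_flow_dist t j x i : 0 <= t <= T -> C1 (phi t) -> C1 (phi' t) ->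
  `|pd (phi t) j x ord0 i - pd (phi' t) j x ord0 i|
    <= 2 * (eps * diff_const) / la * expR (la * t).
Proof.
move=> tT [_ [df _]] [_ [df' _]].
have d1 := derivable_is_derive i (df j x); have d2 := derivable_is_derive i (df' j x).
have d3 : is_derive x (ebasis R j) (fun y => phi t y ord0 i - phi' t y ord0 i)
  (pd (phi t) j x ord0 i - pd (phi' t) j x ord0 i) by exact: is_deriveB.
apply: (derive_le_lipschitz d3) => h.
have := flow_diff_lip (h *: ebasis R j + x) x i tT; rewrite addrK n1_ebasisZ.
have -> : 2 * (eps * (diff_const * `|h|)) / la * expR (la * t) =
  2 * (eps * diff_const) / la * expR (la * t) * `|h| by ring.
by apply: le_trans; rewrite le_eqVlt; apply/orP; left; apply/eqP; congr (`|_|); ring.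
Qed.

End Distance.
End Uniqueness.

(** * Uniqueness: halving the distance between two solutions *)

Section UniqueSolution.
Variables (R : realType) (d : nat).
Local Notation V := 'rV[R]_d.
Local Notation dR := (d%:R : R).
Variables (B : current R d -> V -> V) (CB T : R).
Hypothesis CB_gt0 : 0 < CB.
Hypothesis T_gt0 : 0 < T.
Hypothesis B_Cb2 : forall xi, isM xi -> Cb2 (B xi).
Hypothesis B_bounds : forall xi xi', isM xi -> isM xi' ->
     [/\ C2norm (B xi) <= CB * (wnorm xi + 1),
         supn (fun x => B xi x - B xi' x) <= CB * wnorm (subM xi xi') &
         Ddist (B xi) (B xi') <= CB * wnorm (subM xi xi')].

Lemma wnorm_subM_le (xi xi' : current R d) : isM xi -> isM xi' ->
  wnorm (subM xi xi') <= wnorm xi + wnorm xi'.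
Proof.
move=> m m'; apply: wnorm_le => th wth; have cth : Cb th by case: wth.
have := wnorm_ub m wth; have := wnorm_ub m' (weak_ballN wth).
by rewrite isMZ// /subM; lra.
Qed.

Lemma flow_solution_unique (xi0 : current R d) (xi xi' : R -> current R d) : isM xi0 ->
  flow_solution B xi0 T xi -> flow_solution B xi0 T xi' ->
  forall t, 0 <= t <= T -> eqM (xi t) (xi' t).
Proof.
move=> m0 [mxi [cxi [phi [fphi C1phi pphi]]]] [mxi' [cxi' [phi' [fphi' C1phi' pphi']]]].
have [M HM] := wnorm_bounded T_gt0 mxi cxi; have [M' HM'] := wnorm_bounded T_gt0 mxi' cxi'.
have z0 : 0 <= (0 : R) <= T by rewrite lexx ltW.
have M0 : 0 <= M by apply: le_trans (HM 0 z0); exact: wnorm_ge0 (mxi 0 z0).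
have M'0 : 0 <= M' by apply: le_trans (HM' 0 z0); exact: wnorm_ge0 (mxi' 0 z0).
have CB0 := ltW CB_gt0.
pose K := CB * (M + M' + 1).
have K0 : 0 <= K by rewrite mulr_ge0// !addr_ge0.
have rxi t : 0 <= t <= T -> regular K (B (xi t)).
  move=> tT; apply: (B_regular B_Cb2 B_bounds (mxi t tT)); rewrite /K ler_pM2l//.
  by have := HM t tT; lra.
have rxi' t : 0 <= t <= T -> regular K (B (xi' t)).
  move=> tT; apply: (B_regular B_Cb2 B_bounds (mxi' t tT)); rewrite /K ler_pM2l//.
  by have := HM' t tT; lra.
have dR0 : 0 <= dR by exact: ler0n.
have nm0 : 0 <= normM xi0 by exact: normM_ge0.
pose E := lip_const d T K; pose D := diff_const d CB T K.
have E0 : 0 <= E by rewrite /E /lip_const mulr_ge0// expR_ge0.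
have dE0 : 0 <= dR * E by exact: mulr_ge0.
have D0 : 0 <= D.
  apply: addr_ge0; first exact: mulr_ge0.
  by apply: mulr_ge0; [exact: mulr_ge0|rewrite mulr_ge0// mulr_ge0].
(* The constant that [wnorm_pullB] yields from [flow_dist] and [pd_flow_dist], plus 1 for
   positivity. *)
pose C4 := dR * (dR * (dR * (2 * CB) * E + 2 * D)) + 1.
have C40 : 0 < C4.
  by rewrite ltr_wpDl// mulr_ge0// mulr_ge0// addr_ge0// ?mulr_ge0// mulr_ge0// mulr_ge0.
(* The first two terms meet the demands of the flow estimates; the last one makes
   [normM xi0 * C4 / la] at most one half. *)
pose la := 2 * (dR * K) + 1 + 2 * (normM xi0 * C4).
have p1 : 0 <= dR * K by rewrite mulr_ge0.
have p2 : 0 <= normM xi0 * C4 by rewrite mulr_ge0// ltW.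
have la1 : 1 <= la by rewrite /la; lra.
have Kla : 2 * (dR * K) <= la by rewrite /la; lra.
have la0 : 0 < la by exact: lt_le_trans la1.
pose eps n := (M + M' + 1) / 2 ^+ n.
have eps0 n : 0 < eps n by rewrite /eps divr_gt0 ?exprn_gt0// ltr_wpDl// addr_ge0.
have dist n t : 0 <= t <= T -> wnorm (subM (xi t) (xi' t)) <= eps n * expR (la * t).
  elim: n t => [|n IH] t tT.
    apply: (le_trans (wnorm_subM_le (mxi t tT) (mxi' t tT))).
    apply: (@le_trans _ _ (eps 0%N)).
      by rewrite /eps expr0 divr1; have := HM t tT; have := HM' t tT; lra.
    rewrite ler_peMr//; first exact: ltW.
    by rewrite -expR0 ler_expR mulr_ge0//; [exact: ltW|case/andP: tT].
  set e := expR (la * t); have e0 : 0 < e by exact: expR_gt0.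
  have cphi := C1phi t tT; have cphi' := C1phi' t tT.
  have b1 j x i := pd_flow_le T_gt0 K0 rxi fphi j x i tT cphi.
  have b2 j x i := pd_flow_le T_gt0 K0 rxi' fphi' j x i tT cphi'.
  have d1 x : n1 (phi t x - phi' t x) <= dR * (2 * (CB * eps n) / la * e).
    apply: n1_le => i; rewrite !mxE.
    exact: (flow_dist CB_gt0 T_gt0 B_Cb2 B_bounds mxi mxi' K0 rxi' fphi fphi'
      (ltW (eps0 n)) la1 Kla IH).
  have d2 j x i : `|pd (phi t) j x ord0 i - pd (phi' t) j x ord0 i| <= 2 * (eps n * D) / la * e.
    exact: (pd_flow_dist CB_gt0 T_gt0 B_Cb2 B_bounds mxi mxi' K0 rxi rxi' fphi fphi'
      (ltW (eps0 n)) la1 Kla IH).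
  have [cp [_ cpd]] := cphi; have [cp' [_ cpd']] := cphi'.
  have c0 : 0 < C4 * (eps n / la * e).
    by apply: mulr_gt0 => //; apply: mulr_gt0 => //; exact: divr_gt0.
  have := wnorm_pullB m0 cp cp' cpd cpd' E0 b1 b2 d1 d2 c0.
  have q0 : 0 <= eps n / la * e by apply/ltW/mulr_gt0 => //; exact: divr_gt0.
  move=> /(_ _)/wrap[|H].
    rewrite -subr_ge0; have -> : C4 * (eps n / la * e) -
      dR * (dR * (dR * (2 * (CB * eps n) / la * e) * E + 2 * (eps n * D) / la * e)) =
      eps n / la * e by rewrite /C4; ring.
    exact: q0.
  have : wnorm (subM (xi t) (xi' t)) <= normM xi0 * (C4 * (eps n / la * e)).
    (* A solution agrees with the push-forward of [xi0] only on fields in [Cb], so the comparison is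
       made test field by test field. *)
    apply: le_trans H; apply: wnorm_le => th wth; have cth : Cb th by case: wth.
    have mp := isM_pull m0 cp cpd E0 b1; have mp' := isM_pull m0 cp' cpd' E0 b2.
    apply: le_trans (wnorm_ub (isM_subM mp mp') wth).
    by rewrite /subM (pphi t tT th cth) (pphi' t tT th cth).
  move=> /le_trans; apply.
  have -> : normM xi0 * (C4 * (eps n / la * e)) = normM xi0 * C4 / la * (eps n * e) by ring.
  have -> : eps n.+1 * e = 2^-1 * (eps n * e).
    by rewrite /eps exprS invfM; field; rewrite expf_neq0.
  rewrite ler_wpM2r//; first by rewrite mulr_ge0// ltW.
  by rewrite ler_pdivrMr// /la; lra.
(* [flow_dist] holds with every [eps n], so the flows coincide and with them the push-forwards on
   all of [Cb]. *)
move=> t tT th cth; rewrite (pphi t tT th cth) (pphi' t tT th cth).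
suff -> : phi t = phi' t by [].
apply/funext => x; apply/rowP => i; apply/eqP; rewrite -subr_eq0 -normr_le0.
apply: (@le_of_dyadic _ _ _ (2 * (CB * (M + M' + 1)) / la * expR (la * t))) => n.
rewrite add0r.
apply: (le_trans (flow_dist CB_gt0 T_gt0 B_Cb2 B_bounds mxi mxi' K0 rxi' fphi fphi'
      (ltW (eps0 n)) la1 Kla (dist n) x i tT)).
rewrite le_eqVlt; apply/orP; left; apply/eqP.
by rewrite /eps; field; rewrite expf_neq0//= gt_eqF.
Qed.

End UniqueSolution.

Theorem theorem3p4 (R : realType) (d : nat) (B : current R d -> 'rV[R]_d -> 'rV[R]_d) :
  standing B ->
  exists TR : R -> R,
    forall xi0 : current R d, isM xi0 ->
      let T := TR (normM xi0) in
      [/\ 0 < T,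
          exists xi : R -> current R d, flow_solution B xi0 T xi &
          forall xi xi' : R -> current R d,
            flow_solution B xi0 T xi -> flow_solution B xi0 T xi' ->
            forall t, 0 <= t <= T -> eqM (xi t) (xi' t)].
Proof.
(* [CB] comes from [B] alone, so the time depends on [xi0] only through its dual norm. *)
move=> [B2 [_ [CB CB0 HB]]]; exists (Tconst d CB) => xi0 mxi0 T.
have T0 : 0 < T by exact: Tconst_gt0.
split=> //; first exact: (flow_exists CB0 B2 HB mxi0).
by move=> xi xi'; exact: (flow_solution_unique CB0 T0 B2 HB mxi0).
Qed.
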